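(* Let $E\in M(B\otimes C)$ be a regular separability idempotent and let $(A,\Delta)$ be the associated weak multiplier Hopf algebra, $A=C\otimes B$, $\Delta(cb)=(c\otimes 1)E(1\otimes b)$. For any non-zero linear functional $g$ on $B$, the functional $\varphi$ on $A$ given by $\varphi(cb)=\varphi_C(c)g(b)$ ($b\in B$, $c\in C$) is a left integral on $A$, and any left integral on $A$ has this form. Similarly, for any non-zero linear functional $f$ on $C$, the functional $\psi$ on $A$ given by $\psi(cb)=f(c)\varphi_B(b)$ is a right integral on $A$, and any right integral on $A$ has this form. Moreover, the functional $cb\mapsto \varphi_C(c)\varphi_B(b)$ is a faithful left integral that is also a right integral.
   Context: Algebras are over $\mathbb C$, not necessarily unital, with non-degenerate product and idempotent ($A^2=A$); $M(\cdot)$ denotes the multiplier algebra. A linear functional $\omega$ on an algebra is faithful if $\omega(ab)=0$ for all $b$ implies $a=0$, and $\omega(ba)=0$ for all $b$ implies $a=0$. Let $B,C$ be such algebras. A regular separability idempotent is an idempotent $E\in M(B\otimes C)$ such that: (i) $E(1\otimes c)$ and $(b\otimes 1)E$ lie in $B\otimes C$ for all $b\in B,c\in C$; (ii) $E$ is full: $B$ is the smallest subspace $V$ with $E(1\otimes c)\in V\otimes C$ for all $c$, and $C$ is the smallest subspace $W$ with $(b\otimes 1)E\in B\otimes W$ for all $b$; (iii) there are anti-isomorphisms $S_B:B\to C$ and $S_C:C\to B$ with $E(b\otimes 1)=E(1\otimes S_B(b))$ and $(1\otimes c)E=(S_C(c)\otimes 1)E$. There are unique linear functionals $\varphi_B$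 on $B$, $\varphi_C$ on $C$ (the distinguished functionals) with $(\varphi_B\otimes\iota)E=1$ in $M(C)$ and $(\iota\otimes\varphi_C)E=1$ in $M(B)$, i.e. $(\varphi_B\otimes\iota)(E(1\otimes c))=c$ and $(\iota\otimes\varphi_C)((b\otimes 1)E)=b$. Known facts: they are faithful; $\varphi_C=\varphi_B\circ S_C$, $\varphi_B=\varphi_C\circ S_B$; $(S_B\otimes S_C)E=\zeta E$ ($\zeta$ the flip). $A=C\otimes B$ (tensor product algebra); $B$ and $C$ are identified with their images $1\otimes B$, $C\otimes 1$ in $M(A)$, so $A$ is spanned by the elements $cb=bc$ ($=c\otimes b$). The coproduct $\Delta:A\to M(A\otimes A)$ is $\Delta(cb)=(c\otimes 1)E(1\otimes b)$ (that is, $\Delta(c\otimes b)=c\otimes E\otimes b$). Put $A_t=M(C)$ and $A_s=M(B)$, seen inside $M(A)$. A left integral on $A$ is a non-zero linear functional $\varphi$ with $(\iota\otimes\varphi)\Delta(a)\in A_t$ for all $a\in A$; a right integral is a non-zero linear functional $\psi$ with $(\psi\otimes\iota)\Delta(a)\in A_s$ for all $a\in A$ (these are multipliers of $A$, e.g. $a'\,(\iota\otimes\varphi)\Delta(a)=(\iota\otimes\varphi)((a'\otimes 1)\Delta(a))$). *)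

(* Defs.v *)
From HB Require Import structures.
From mathcomp Require Import all_boot all_order all_algebra.
From mathcomp Require Import boolp.

Set Implicit Arguments.
Unset Strict Implicit.
Unset Printing Implicit Defensive.

Import GRing.Theory.
Local Open Scope ring_scope.
Local Open Scope quotient_scope.

Reserved Notation "B ⊗ C" (at level 40, left associativity).
Reserved Notation "x ** y" (at level 40, left associativity).

Notation bilinear_map f := (bilinear_for *:%R *:%R f).

(* A formal sum b_1 (x) c_1 + ... + b_n (x) c_n is the list of the pairs      *)
(* (b_i, c_i); [teq] is the congruence generated by the bilinearity relations.*)
(* Scalars need no separate formal symbol: k(b (x) c) is (kb) (x) c.          *)
Section TensorDef.
Variables (K : fieldType) (B C : lmodType K).

Inductive teq : seq (B * C) -> seq (B * C) -> Prop :=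
| teq_refl s : teq s s
| teq_sym s t : teq s t -> teq t s
| teq_trans s t u : teq s t -> teq t u -> teq s u
| teq_perm s t : perm_eq s t -> teq s t
| teq_cat s s' t t' : teq s s' -> teq t t' -> teq (s ++ t) (s' ++ t')
| teq_zero c : teq [:: (0, c)] [::]
| teq_addl b b' c : teq [:: (b + b', c)] [:: (b, c); (b', c)]
| teq_addr b c c' : teq [:: (b, c + c')] [:: (b, c); (b, c')]
| teq_scale k b c : teq [:: (k *: b, c)] [:: (b, k *: c)].

Definition teqb s t := `[< teq s t >].

Lemma teqb_equiv : equiv_class_of teqb.
Proof.
split.
- by move=> s; apply/asboolP; exact: teq_refl.
- by move=> s t; apply/asboolP/asboolP; exact: teq_sym.
- move=> t s u /asboolP st /asboolP tu; apply/asboolP; exact: teq_trans tu.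
Qed.

Canonical teq_equiv_rel := EquivRelPack teqb_equiv.

Definition tensor := {eq_quot teqb}.
HB.instance Definition _ := Choice.on tensor.
HB.instance Definition _ := EqQuotient.on tensor.

Definition tens (b : B) (c : C) : tensor := \pi_tensor [:: (b, c)].

Lemma piP s t : (\pi_tensor s = \pi_tensor t) <-> teq s t.
Proof.
split; first by move/eqmodP/asboolP.
by move=> h; apply/eqmodP/asboolP.
Qed.

Lemma teq_repr s : teq (repr (\pi_tensor s)) s.
Proof. by apply/piP; rewrite reprK. Qed.

Definition tadd (x y : tensor) : tensor := \pi_tensor (repr x ++ repr y).
Definition tmap (k : K) (s : seq (B * C)) := [seq (k *: p.1, p.2) | p <- s].
Definition tscale k (x : tensor) : tensor := \pi_tensor (tmap k (repr x)).
Definition tzero : tensor := \pi_tensor [::].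
Definition topp (x : tensor) := tscale (-1) x.

Lemma taddE s t : tadd (\pi_tensor s) (\pi_tensor t) = \pi_tensor (s ++ t).
Proof. by apply/piP; apply: teq_cat; exact: teq_repr. Qed.

Lemma teq_tmap k s t : teq s t -> teq (tmap k s) (tmap k t).
Proof.
elim=> {s t}.
- by move=> s; exact: teq_refl.
- by move=> s t _; exact: teq_sym.
- by move=> s t u _ h1 _; exact: teq_trans.
- by move=> s t h; apply: teq_perm; exact: perm_map.
- by move=> s s' t t' _ h1 _ h2; rewrite /tmap !map_cat; exact: teq_cat.
- by move=> c /=; rewrite scaler0; exact: teq_zero.
- by move=> b b' c /=; rewrite scalerDr; exact: teq_addl.
- by move=> b c c' /=; exact: teq_addr.
- by move=> l b c /=; rewrite scalerA mulrC -scalerA; exact: teq_scale.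
Qed.

Lemma tscaleE k s : tscale k (\pi_tensor s) = \pi_tensor (tmap k s).
Proof. by apply/piP; apply: teq_tmap; exact: teq_repr. Qed.

Lemma tensor_piP (P : tensor -> Prop) : (forall s, P (\pi_tensor s)) -> forall x, P x.
Proof. by move=> h x; rewrite -[x]reprK. Qed.

Lemma taddA : associative tadd.
Proof.
elim/tensor_piP=> s; elim/tensor_piP=> t; elim/tensor_piP=> u.
by rewrite !taddE catA.
Qed.
Lemma taddC : commutative tadd.
Proof.
elim/tensor_piP=> s; elim/tensor_piP=> t; rewrite !taddE.
by apply/piP/teq_perm; rewrite perm_catC.
Qed.
Lemma tadd0 : left_id tzero tadd.
Proof. by elim/tensor_piP=> s; rewrite !taddE. Qed.

Lemma tscaleDl x a b : tscale (a + b) x = tadd (tscale a x) (tscale b x).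
Proof.
elim/tensor_piP: x => s; rewrite !tscaleE taddE; apply/piP.
elim: s => [|[x y] s ih] /=; first exact: teq_refl.
apply: (@teq_trans _ ([:: (a *: x, y); (b *: x, y)] ++ (tmap a s ++ tmap b s))).
  rewrite -[_ :: _]cat1s; apply: teq_cat => //.
  by rewrite scalerDl; exact: teq_addl.
apply: teq_perm => /=; rewrite perm_cons.
by rewrite -[(b *: x, y) :: tmap b s]cat1s -cat1s perm_catCA.
Qed.

Lemma tscale0 x : tscale 0 x = tzero.
Proof.
elim/tensor_piP: x => s; rewrite tscaleE; apply/piP.
elim: s => [|[x y] s ih] /=; first exact: teq_refl.
rewrite -cat1s -[[::]]cats0; apply: teq_cat => //.
by rewrite scale0r; exact: teq_zero.
Qed.

Lemma tscale1 : left_id 1 tscale.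
Proof.
elim/tensor_piP=> s; rewrite tscaleE; congr (\pi_tensor _).
by elim: s => //= -[x y] s ->; rewrite scale1r.
Qed.

Lemma taddN : left_inverse tzero topp tadd.
Proof.
by move=> x; rewrite /topp -{2}[x]tscale1 -tscaleDl addNr tscale0.
Qed.

Lemma tscaleA a b x : tscale a (tscale b x) = tscale (a * b) x.
Proof.
elim/tensor_piP: x => s; rewrite !tscaleE; congr (\pi_tensor _).
by rewrite /tmap -map_comp; apply: eq_map => -[x y] /=; rewrite scalerA.
Qed.

Lemma tscaleDr : right_distributive tscale tadd.
Proof.
move=> a; elim/tensor_piP=> s; elim/tensor_piP=> t.
by rewrite taddE !tscaleE taddE /tmap map_cat.
Qed.

HB.instance Definition _ := GRing.isZmodule.Build tensor taddA taddC tadd0 taddN.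
HB.instance Definition _ := GRing.Zmodule_isLmodule.Build K tensor
  tscaleA tscale1 tscaleDr tscaleDl.

Lemma pi_sum s : \pi_tensor s = \sum_(p <- s) tens p.1 p.2.
Proof.
elim: s => [|[b c] s ih]; first by rewrite big_nil.
by rewrite big_cons -ih -[RHS]/(tadd _ _) taddE.
Qed.

Lemma tensor_sum (x : tensor) : x = \sum_(p <- repr x) tens p.1 p.2.
Proof. by rewrite -pi_sum reprK. Qed.

Lemma tensZl k b c : tens (k *: b) c = k *: tens b c.
Proof. by rewrite -[RHS]/(tscale _ _) tscaleE. Qed.
Lemma tensZr k b c : tens b (k *: c) = k *: tens b c.
Proof. by rewrite -tensZl; symmetry; apply/piP; exact: teq_scale. Qed.
Lemma tensDl b b' c : tens (b + b') c = tens b c + tens b' c.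
Proof. by rewrite -[RHS]/(tadd _ _) taddE; apply/piP; exact: teq_addl. Qed.
Lemma tensDr b c c' : tens b (c + c') = tens b c + tens b c'.
Proof. by rewrite -[RHS]/(tadd _ _) taddE; apply/piP; exact: teq_addr. Qed.

Lemma tens_bilinear : bilinear_map tens.
Proof.
by split=> [c k b b'|b k c c'] /=; rewrite ?(tensDl, tensDr) ?(tensZl, tensZr).
Qed.

Lemma tensor_ind (P : tensor -> Prop) :
  P 0 -> (forall x y, P x -> P y -> P (x + y)) -> (forall b c, P (tens b c)) ->
  forall x, P x.
Proof. by move=> P0 PD Pt x; rewrite [x]tensor_sum; exact: big_ind. Qed.

End TensorDef.

Arguments tensor {K} (B C)%_type_scope.
Notation "B ⊗ C" := (tensor B C) : type_scope.
Notation "b ⊗ c" := (tens b c) : ring_scope.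

(* [tlift f] is independent of the representative chosen, and linear, only    *)
(* when f is bilinear: see [tlift_tens] and [tlift_linear].                   *)
Section Lift.
Variables (K : fieldType) (B C V : lmodType K).

Definition tlift (f : B -> C -> V) (x : B ⊗ C) : V :=
  \sum_(p <- repr x) f p.1 p.2.

Variable f : B -> C -> V.
Hypothesis fbil : bilinear_map f.

Lemma bil_facts :
  [/\ forall c, f 0 c = 0, forall b b' c, f (b + b') c = f b c + f b' c,
      forall b c c', f b (c + c') = f b c + f b c',
      forall k b c, f (k *: b) c = k *: f b c &
      forall k b c, f b (k *: c) = k *: f b c].
Proof.
case: fbil => f1 f2.
have fDl b b' c : f (b + b') c = f b c + f b' c.
  by have := f1 c 1 b b'; rewrite /= !scale1r.
have fDr b c c' : f b (c + c') = f b c + f b c'.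
  by have := f2 b 1 c c'; rewrite /= !scale1r.
have f0l c : f 0 c = 0.
  by apply: (addrI (f 0 c)); rewrite -fDl !addr0.
have f0r b : f b 0 = 0.
  by apply: (addrI (f b 0)); rewrite -fDr !addr0.
split=> //.
  by move=> k b c; have := f1 c k b 0; rewrite /= f0l !addr0.
by move=> k b c; have := f2 b k c 0; rewrite /= f0r !addr0.
Qed.

Lemma teq_lift s t : teq s t ->
  \sum_(p <- s) f p.1 p.2 = \sum_(p <- t) f p.1 p.2.
Proof.
have [f0 fDl fDr fZl fZr] := bil_facts.
elim=> {s t} //.
- by move=> s t u _ -> _ ->.
- by move=> s t st; exact: perm_big.
- by move=> s s' t t' _ h1 _ h2; rewrite !big_cat /= h1 h2.
- by move=> c; rewrite big_seq1 big_nil /= f0.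
- by move=> b b' c; rewrite !big_cons !big_nil /= !addr0 fDl.
- by move=> b c c'; rewrite !big_cons !big_nil /= !addr0 fDr.
- by move=> k b c; rewrite !big_cons !big_nil /= !addr0 fZl fZr.
Qed.

Lemma tlift_pi s : tlift f (\pi_(B ⊗ C) s) = \sum_(p <- s) f p.1 p.2.
Proof. by apply: teq_lift; exact: teq_repr. Qed.

Lemma tlift_tens b c : tlift f (b ⊗ c) = f b c.
Proof. by rewrite /tens tlift_pi big_seq1. Qed.

Lemma tlift_linear : linear (tlift f).
Proof.
have [f0 fDl fDr fZl fZr] := bil_facts.
move=> k; elim/tensor_piP=> s; elim/tensor_piP=> t.
rewrite -[X in tlift f X]/(tadd (tscale k _) _) tscaleE taddE !tlift_pi big_cat /=.
congr (_ + _); rewrite scaler_sumr big_map.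
by apply: eq_bigr => -[x y] _ /=; rewrite fZl.
Qed.

End Lift.

Lemma tlift_ext (K : fieldType) (B C V : lmodType K) (F G : B ⊗ C -> V) :
  linear F -> linear G -> (forall b c, F (b ⊗ c) = G (b ⊗ c)) -> F =1 G.
Proof.
move=> lF lG FG x.
have D H : linear H -> forall x y : B ⊗ C, H (x + y) = H x + H y :> V.
  by move=> lH {}x y; have := lH 1 x y; rewrite !scale1r.
have Z H : linear H -> H (0 : B ⊗ C) = 0 :> V.
  by move=> lH; apply: (addrI (H 0)); rewrite -D // !addr0.
elim/tensor_ind: x => [|x y hx hy|//]; first by rewrite !Z.
by rewrite !D // hx hy.
Qed.

HB.mixin Record isNuAlg (K : fieldType) A of GRing.Lmodule K A := {
  nmul : A -> A -> A;
  nmulA : associative nmul;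
  nmul_bilinear : bilinear_map nmul
}.

#[short(type="nuAlgType")]
HB.structure Definition NuAlg (K : fieldType) :=
  { A of isNuAlg K A & GRing.Lmodule K A }.

Notation "x ** y" := (nmul x y) : ring_scope.

Section NuAlgTheory.
Variables (K : fieldType) (A : nuAlgType K).
Implicit Types a b c : A.

Lemma nmulDl a b c : (a + b) ** c = a ** c + b ** c.
Proof. by have [_ h _ _ _] := bil_facts (@nmul_bilinear K A). Qed.
Lemma nmulDr a b c : a ** (b + c) = a ** b + a ** c.
Proof. by have [_ _ h _ _] := bil_facts (@nmul_bilinear K A). Qed.
Lemma nmulZl k a b : (k *: a) ** b = k *: (a ** b).
Proof. by have [_ _ _ h _] := bil_facts (@nmul_bilinear K A). Qed.
Lemma nmulZr k a b : a ** (k *: b) = k *: (a ** b).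
Proof. by have [_ _ _ _ h] := bil_facts (@nmul_bilinear K A). Qed.
Lemma nmul0l a : 0 ** a = 0.
Proof. by rewrite -[0 in LHS](scale0r 0) nmulZl scale0r. Qed.
Lemma nmul0r a : a ** 0 = 0.
Proof. by rewrite -[0 in LHS](scale0r 0) nmulZr scale0r. Qed.

End NuAlgTheory.

Definition nondegenerate_alg (K : fieldType) (A : nuAlgType K) :=
  (forall a : A, (forall b, a ** b = 0) -> a = 0) /\
  (forall a : A, (forall b, b ** a = 0) -> a = 0).

Definition idempotent_alg (K : fieldType) (A : nuAlgType K) :=
  forall a : A, exists s : seq (A * A), a = \sum_(p <- s) p.1 ** p.2.

Definition faithful (K : fieldType) (A : nuAlgType K) (w : {scalar A}) :=
  (forall a : A, (forall b, w (a ** b) = 0) -> a = 0) /\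
  (forall a : A, (forall b, w (b ** a) = 0) -> a = 0).

Definition nonzero (K : fieldType) (A : lmodType K) (w : {scalar A}) :=
  exists a, w a != 0.

Section TensorAlg.
Variables (K : fieldType) (B C : nuAlgType K).

Definition tmul (x y : B ⊗ C) : B ⊗ C :=
  tlift (fun b c => tlift (fun b' c' => (b ** b') ⊗ (c ** c')) y) x.

Let inner b c : bilinear_map (fun b' c' => (b ** b') ⊗ (c ** c') : B ⊗ C).
Proof.
by split=> [c' k x y|b' k x y] /=;
   rewrite nmulDr nmulZr ?(tensDl, tensDr) ?(tensZl, tensZr).
Qed.

Let outer y :
  bilinear_map (fun b c => tlift (fun b' c' => (b ** b') ⊗ (c ** c') : B ⊗ C) y).
Proof.
split=> [c k x x'|b k x x'] /=; rewrite /tlift scaler_sumr -big_split /=;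
  by apply: eq_bigr => p _;
     rewrite nmulDl nmulZl ?(tensDl, tensDr) ?(tensZl, tensZr).
Qed.

Lemma tmul_tens b c b' c' : tmul (b ⊗ c) (b' ⊗ c') = (b ** b') ⊗ (c ** c').
Proof. by rewrite /tmul tlift_tens ?tlift_tens. Qed.

Lemma tmul_bilinear : bilinear_map tmul.
Proof.
split=> [y k x x'|x k y y'] /=; first exact: tlift_linear.
rewrite /tmul scaler_sumr -big_split; apply: eq_bigr => p _.
by rewrite tlift_linear.
Qed.

Lemma tmulA : associative tmul.
Proof.
have [m0 mDl mDr mZl mZr] := bil_facts tmul_bilinear.
have m0r x : tmul x 0 = 0 by rewrite -[0 in LHS](scale0r 0) mZr scale0r.
move=> x y z; elim/tensor_ind: x => [|x x' h h'|b c]; first by rewrite !m0.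
  by rewrite !mDl h h'.
elim/tensor_ind: y => [|y y' h h'|b' c']; first by rewrite !(m0, m0r).
  by rewrite !(mDl, mDr) h h'.
elim/tensor_ind: z => [|z z' h h'|b'' c'']; first by rewrite !m0r.
  by rewrite !mDr h h'.
by rewrite !tmul_tens !nmulA.
Qed.

HB.instance Definition _ := isNuAlg.Build K (tensor B C) tmulA tmul_bilinear.

Lemma nmul_tens (b b' : B) (c c' : C) :
  (b ⊗ c) ** (b' ⊗ c') = (b ** b') ⊗ (c ** c').
Proof. exact: tmul_tens. Qed.

End TensorAlg.

(* A multiplier m is the pair of maps a |-> m a (mulL) and a |-> a m (mulR).  *)
Record multiplier (K : fieldType) (A : nuAlgType K) := Multiplier {
  mulL : A -> A;
  mulR : A -> A;
  mulL_linear : linear mulL;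
  mulR_linear : linear mulR;
  mulLM : forall a b, mulL (a ** b) = mulL a ** b;
  mulRM : forall a b, mulR (a ** b) = a ** mulR b;
  mulRL : forall a b, mulR a ** b = a ** mulL b
}.

Arguments multiplier {K} A%_type_scope.

HB.instance Definition _ K A := gen_eqMixin (@multiplier K A).
HB.instance Definition _ K A := gen_choiceMixin (@multiplier K A).
HB.instance Definition _ (K : fieldType) (A : nuAlgType K) (m : multiplier A) :=
  GRing.isLinear.Build K A A _ (mulL m) (mulL_linear m).
HB.instance Definition _ (K : fieldType) (A : nuAlgType K) (m : multiplier A) :=
  GRing.isLinear.Build K A A _ (mulR m) (mulR_linear m).

Section MultiplierAlg.
Variables (K : fieldType) (A : nuAlgType K).
Implicit Types (m n : multiplier A) (a b : A) (k : K).

Lemma multP m n : mulL m =1 mulL n -> mulR m =1 mulR n -> m = n.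
Proof.
case: m n => [L R lL lR h1 h2 h3] [L' R' lL' lR' h1' h2' h3'] /= /funext eL /funext eR.
by subst L' R'; f_equal; exact: Prop_irrelevance.
Qed.

Definition mzero : multiplier A.
Proof.
by apply: (@Multiplier _ _ (fun=> 0) (fun=> 0)) => [k a b|k a b|a b|a b|a b];
  rewrite ?scaler0 ?addr0 ?nmul0l ?nmul0r.
Defined.

Definition mone : multiplier A.
Proof. by apply: (@Multiplier _ _ id id). Defined.

Definition madd m n : multiplier A.
Proof.
by apply: (@Multiplier _ _ (fun a => mulL m a + mulL n a)
                           (fun a => mulR m a + mulR n a)) => [k a b|k a b|a b|a b|a b];
  rewrite ?linearP ?scalerDr ?mulLM ?mulRM ?nmulDl ?nmulDr ?mulRL // addrACA.
Defined.

Definition mscale k m : multiplier A.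
Proof.
by apply: (@Multiplier _ _ (fun a => k *: mulL m a) (fun a => k *: mulR m a))
     => [l a b|l a b|a b|a b|a b];
  rewrite ?linearP ?mulLM ?mulRM ?nmulZl ?nmulZr ?mulRL //
          scalerDr !scalerA mulrC.
Defined.

Definition mopp m := mscale (-1) m.

Definition mmul m n : multiplier A.
Proof.
by apply: (@Multiplier _ _ (mulL m \o mulL n) (mulR n \o mulR m))
     => [l a b|l a b|a b|a b|a b] /=; rewrite ?linearP ?mulLM ?mulRM ?mulRL.
Defined.

Ltac mult_ext := apply: multP => ? /=;
  rewrite ?(addrA, add0r, mulr1, scale1r, scalerA, scalerDl, scalerDr, linearD) //.

Lemma maddA : associative madd. Proof. by move=> ? ? ?; mult_ext. Qed.
Lemma maddC : commutative madd.
Proof. by move=> ? ?; apply: multP => ? /=; rewrite addrC. Qed.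
Lemma madd0 : left_id mzero madd. Proof. by move=> ?; mult_ext. Qed.
Lemma maddN : left_inverse mzero mopp madd.
Proof. by move=> ?; apply: multP => ? /=; rewrite scaleN1r addNr. Qed.
HB.instance Definition _ :=
  GRing.isZmodule.Build (multiplier A) maddA maddC madd0 maddN.

Lemma mmulA : associative mmul. Proof. by move=> ? ? ?; mult_ext. Qed.
Lemma mmul1l : left_id mone mmul. Proof. by move=> ?; mult_ext. Qed.
Lemma mmul1r : right_id mone mmul. Proof. by move=> ?; mult_ext. Qed.
Lemma mmulDl : left_distributive mmul madd.
Proof. by move=> ? ? ?; mult_ext. Qed.
Lemma mmulDr : right_distributive mmul madd.
Proof. by move=> ? ? ?; mult_ext. Qed.
HB.instance Definition _ :=
  GRing.Zmodule_isPzRing.Build (multiplier A) mmulA mmul1l mmul1r mmulDl mmulDr.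

Lemma mscaleA k l m : mscale k (mscale l m) = mscale (k * l) m.
Proof. by mult_ext. Qed.
Lemma mscale1 : left_id 1 mscale. Proof. by move=> ?; mult_ext. Qed.
Lemma mscaleDr : right_distributive mscale +%R.
Proof. by move=> ? ? ?; mult_ext. Qed.
Lemma mscaleDl m : {morph mscale^~ m : k l / k + l}.
Proof. by move=> ? ?; mult_ext. Qed.
HB.instance Definition _ := GRing.Zmodule_isLmodule.Build K (multiplier A)
  mscaleA mscale1 mscaleDr mscaleDl.

Lemma mulL1 a : mulL 1 a = a. Proof. by []. Qed.
Lemma mulR1 a : mulR 1 a = a. Proof. by []. Qed.
Lemma mulLmul m n a : mulL (m * n) a = mulL m (mulL n a). Proof. by []. Qed.
Lemma mulRmul m n a : mulR (m * n) a = mulR n (mulR m a). Proof. by []. Qed.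
Lemma mulLD m n a : mulL (m + n) a = mulL m a + mulL n a. Proof. by []. Qed.
Lemma mulRD m n a : mulR (m + n) a = mulR m a + mulR n a. Proof. by []. Qed.
Lemma mulLZ k m a : mulL (k *: m) a = k *: mulL m a. Proof. by []. Qed.
Lemma mulRZ k m a : mulR (k *: m) a = k *: mulR m a. Proof. by []. Qed.

Lemma mulr_scalel k m n : (k *: m) * n = k *: (m * n).
Proof. by apply: multP => a //; rewrite !(mulRZ, mulRmul) linearZ. Qed.
Lemma mulr_scaler k m n : m * (k *: n) = k *: (m * n).
Proof. by apply: multP => a //; rewrite !(mulLZ, mulLmul) linearZ. Qed.

(* The canonical map A -> M(A), injective when A is nondegenerate. *)
Definition emb a : multiplier A.
Proof.
by apply: (@Multiplier _ _ (fun b => a ** b) (fun b => b ** a))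
     => [k x y|k x y|x y|x y|x y];
  rewrite ?nmulDl ?nmulDr ?nmulZl ?nmulZr ?nmulA.
Defined.

Lemma emb_linear : linear emb.
Proof.
by move=> k a b; apply: multP => x /=;
  rewrite ?nmulDl ?nmulDr ?nmulZl ?nmulZr.
Qed.
HB.instance Definition _ :=
  GRing.isLinear.Build K A (multiplier A) _ emb emb_linear.

End MultiplierAlg.

Section MTens.
Variables (K : fieldType) (B C : nuAlgType K).

Let tmap_bil (f : {linear B -> B}) (g : {linear C -> C}) :
  bilinear_map (fun b c => f b ⊗ g c).
Proof.
by split=> [c k x y|b k x y] /=; rewrite linearP ?(tensDl, tensDr) ?(tensZl, tensZr).
Qed.

Section Def.
Variables (m : multiplier B) (n : multiplier C).

Definition mtensL : B ⊗ C -> B ⊗ C := tlift (fun b c => mulL m b ⊗ mulL n c).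
Definition mtensR : B ⊗ C -> B ⊗ C := tlift (fun b c => mulR m b ⊗ mulR n c).

Lemma mtensL_tens b c : mtensL (b ⊗ c) = mulL m b ⊗ mulL n c.
Proof. by rewrite /mtensL tlift_tens //; exact: tmap_bil. Qed.
Lemma mtensR_tens b c : mtensR (b ⊗ c) = mulR m b ⊗ mulR n c.
Proof. by rewrite /mtensR tlift_tens //; exact: tmap_bil. Qed.
Lemma mtensL_linear : linear mtensL.
Proof. by apply: tlift_linear; exact: tmap_bil. Qed.
Lemma mtensR_linear : linear mtensR.
Proof. by apply: tlift_linear; exact: tmap_bil. Qed.
HB.instance Definition _ := GRing.isLinear.Build K _ _ _ mtensL mtensL_linear.
HB.instance Definition _ := GRing.isLinear.Build K _ _ _ mtensR mtensR_linear.

Let mLD x y : mtensL (x + y) = mtensL x + mtensL y.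
Proof. exact: linearD. Qed.
Let mRD x y : mtensR (x + y) = mtensR x + mtensR y.
Proof. exact: linearD. Qed.
Let mL0 : mtensL 0 = 0. Proof. exact: linear0. Qed.
Let mR0 : mtensR 0 = 0. Proof. exact: linear0. Qed.

Lemma mtensLM x y : mtensL (x ** y) = mtensL x ** y.
Proof.
elim/tensor_ind: x => [|x x' h h'|b c].
- by rewrite nmul0l !(mL0, mR0) nmul0l.
- by rewrite !(nmulDl, mLD, mRD) h h'.
elim/tensor_ind: y => [|y y' h h'|b' c'].
- by rewrite !(nmul0r, mL0, mR0).
- by rewrite !(nmulDr, mLD, mRD) h h'.
by rewrite !(nmul_tens, mtensL_tens) !mulLM.
Qed.

Lemma mtensRM x y : mtensR (x ** y) = x ** mtensR y.
Proof.
elim/tensor_ind: x => [|x x' h h'|b c].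
- by rewrite !nmul0l !(mL0, mR0).
- by rewrite !(nmulDl, mLD, mRD) h h'.
elim/tensor_ind: y => [|y y' h h'|b' c'].
- by rewrite !(nmul0r, mL0, mR0).
- by rewrite !(nmulDr, mLD, mRD) h h'.
by rewrite !(nmul_tens, mtensR_tens) !mulRM.
Qed.

Lemma mtensRL x y : mtensR x ** y = x ** mtensL y.
Proof.
elim/tensor_ind: x => [|x x' h h'|b c].
- by rewrite (mL0, mR0) !nmul0l.
- by rewrite !(nmulDl, mLD, mRD) h h'.
elim/tensor_ind: y => [|y y' h h'|b' c'].
- by rewrite (mL0, mR0) !nmul0r.
- by rewrite !(nmulDr, mLD, mRD) h h'.
by rewrite !(nmul_tens, mtensR_tens, mtensL_tens) !mulRL.
Qed.

Definition mtens : multiplier (B ⊗ C) :=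
  Multiplier mtensL_linear mtensR_linear mtensLM mtensRM mtensRL.

End Def.

Lemma mulL_mtens m n b c : mulL (mtens m n) (b ⊗ c) = mulL m b ⊗ mulL n c.
Proof. exact: mtensL_tens. Qed.
Lemma mulR_mtens m n b c : mulR (mtens m n) (b ⊗ c) = mulR m b ⊗ mulR n c.
Proof. exact: mtensR_tens. Qed.

Lemma mtens_bilinear : bilinear_map mtens.
Proof.
split=> [n k m m'|m k n n'] /=; apply: multP;
  apply: tlift_ext; try exact: mulL_linear; try exact: mulR_linear;
  move=> b c; rewrite !(mulLD, mulRD) !(mulLZ, mulRZ) !(mulL_mtens, mulR_mtens)
    !(mulLD, mulRD) !(mulLZ, mulRZ);
  by rewrite ?(tensDl, tensDr) ?(tensZl, tensZr).
Qed.

End MTens.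

(* The multiplier 1 ⊗ N ⊗ 1 of (C ⊗ B) ⊗ (C ⊗ B), for N in M(B ⊗ C): it acts  *)
(* on the two middle factors.                                                 *)
Section Leg23.
Variables (K : fieldType) (B C : nuAlgType K).
Local Notation A := (C ⊗ B)%type.

Definition insert14 (c : C) (b : B) : B ⊗ C -> A ⊗ A :=
  tlift (fun b' c' => (c ⊗ b') ⊗ (c' ⊗ b)).

Definition act23 (N : B ⊗ C -> B ⊗ C) : A ⊗ A -> A ⊗ A :=
  tlift (fun x y => tlift (fun c b' =>
    tlift (fun c' b => insert14 c b (N (b' ⊗ c'))) y) x).

Let insert_bil c b : bilinear_map (fun b' c' => (c ⊗ b') ⊗ (c' ⊗ b) : A ⊗ A).
Proof.
by split=> [c' k x y|b' k x y] /=; do ?rewrite ?(tensDl, tensDr) ?(tensZl, tensZr).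
Qed.

Lemma insert14_tens c b b' c' : insert14 c b (b' ⊗ c') = (c ⊗ b') ⊗ (c' ⊗ b).
Proof. by rewrite /insert14 tlift_tens. Qed.
Lemma insert14_linear c b : linear (insert14 c b).
Proof. exact: tlift_linear. Qed.
HB.instance Definition _ c b :=
  GRing.isLinear.Build K _ _ _ (insert14 c b) (insert14_linear c b).

Lemma insert14_bilinear z : bilinear_map (fun c b => insert14 c b z).
Proof.
split=> [b k c c'|c k b b'] /=; rewrite /insert14 /tlift scaler_sumr -big_split /=;
  by apply: eq_bigr => p _; rewrite ?(tensDl, tensDr) ?(tensZl, tensZr)
       ?(tensDl, tensDr) ?(tensZl, tensZr).
Qed.

Section Act.
Variable N : {linear tensor B C -> tensor B C}.

Let bil1 c b' : bilinear_map (fun c' b => insert14 c b (N (b' ⊗ c'))).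
Proof.
split=> [b k x y|c' k x y] /=; first by rewrite tensDr tensZr !linearP.
have [_ _ iDr _ iZr] := bil_facts (insert14_bilinear (N (b' ⊗ c'))).
by rewrite iDr iZr.
Qed.

Let bil2 y :
  bilinear_map (fun c b' => tlift (fun c' b => insert14 c b (N (b' ⊗ c'))) y).
Proof.
split=> [b' k c c2|c k b b2] /=; rewrite /tlift scaler_sumr -big_split /=;
  apply: eq_bigr => p _; last by rewrite tensDl tensZl !linearP.
have [_ iDl _ iZl _] := bil_facts (insert14_bilinear (N (b' ⊗ p.1))).
by rewrite iDl iZl.
Qed.

Let bil3 : bilinear_map (fun x y => tlift (fun c b' =>
    tlift (fun c' b => insert14 c b (N (b' ⊗ c'))) y) x).
Proof.
split=> [y k x x'|x k y y'] /=; first exact: tlift_linear.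
rewrite {1 3 5}/tlift scaler_sumr -big_split /=; apply: eq_bigr => p _.
by rewrite tlift_linear.
Qed.

Lemma act23_tens c b' c' b :
  act23 N ((c ⊗ b') ⊗ (c' ⊗ b)) = insert14 c b (N (b' ⊗ c')).
Proof. by rewrite /act23 !tlift_tens. Qed.
Lemma act23_linear : linear (act23 N).
Proof. exact: tlift_linear. Qed.

Lemma act23_insert c b z : act23 N (insert14 c b z) = insert14 c b (N z).
Proof.
have lin := act23_linear.
apply: (tlift_ext (F := fun z => act23 N (insert14 c b z))
                  (G := fun z => insert14 c b (N z)) _ _ _ z).
- by move=> k x y; rewrite linearP lin.
- by move=> k x y; rewrite !linearP.
by move=> b' c'; rewrite insert14_tens act23_tens.
Qed.

End Act.

Lemma tensor4_ind (P : A ⊗ A -> Prop) :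
  P 0 -> (forall x y, P x -> P y -> P (x + y)) ->
  (forall c b z, P (insert14 c b z)) -> forall x, P x.
Proof.
move=> P0 PD Pi; elim/tensor_ind => // x y.
have t0l w : (0 : A) ⊗ (w : A) = 0 by rewrite -(scale0r 0) tensZl scale0r.
have t0r w : (w : A) ⊗ (0 : A) = 0 by rewrite -(scale0r 0) tensZr scale0r.
elim/tensor_ind: x => [|x x' h h'|c b']; first by rewrite t0l.
  by rewrite tensDl; exact: PD.
elim/tensor_ind: y => [|y y' h h'|c' b]; first by rewrite t0r.
  by rewrite tensDr; exact: PD.
by rewrite -insert14_tens.
Qed.

Lemma insert14M c b c' b' z z' :
  insert14 c b z ** insert14 c' b' z' = insert14 (c ** c') (b ** b') (z ** z').
Proof.
elim/tensor_ind: z => [|x x' h h'|b2 c2].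
- by rewrite nmul0l !linear0 nmul0l.
- by rewrite !(nmulDl, linearD) h h'.
elim/tensor_ind: z' => [|y y' h h'|b3 c3].
- by rewrite nmul0r !linear0 nmul0r.
- by rewrite !(nmulDr, linearD) h h'.
by rewrite !(insert14_tens, nmul_tens).
Qed.

Section Def.
Variable N : multiplier (B ⊗ C).

Let L := act23 (mulL N).
Let R := act23 (mulR N).

Fact leg23L_linear : linear L. Proof. exact: act23_linear. Qed.
Fact leg23R_linear : linear R. Proof. exact: act23_linear. Qed.

Let LD x y : L (x + y) = L x + L y.
Proof. by have := leg23L_linear 1 x y; rewrite !scale1r. Qed.
Let RD x y : R (x + y) = R x + R y.
Proof. by have := leg23R_linear 1 x y; rewrite !scale1r. Qed.
Let L0 : L 0 = 0.
Proof. by apply: (addrI (L 0)); rewrite -LD !addr0. Qed.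
Let R0 : R 0 = 0.
Proof. by apply: (addrI (R 0)); rewrite -RD !addr0. Qed.

Fact leg23LM x y : L (x ** y) = L x ** y.
Proof.
elim/tensor4_ind: x => [|x x' h h'|c b z]; first by rewrite nmul0l L0 nmul0l.
  by rewrite nmulDl !LD nmulDl h h'.
elim/tensor4_ind: y => [|y y' h h'|c' b' z']; first by rewrite !nmul0r L0.
  by rewrite !nmulDr LD h h'.
by rewrite insert14M /L !act23_insert insert14M /= mulLM.
Qed.

Fact leg23RM x y : R (x ** y) = x ** R y.
Proof.
elim/tensor4_ind: x => [|x x' h h'|c b z]; first by rewrite !nmul0l R0.
  by rewrite !nmulDl RD h h'.
elim/tensor4_ind: y => [|y y' h h'|c' b' z']; first by rewrite nmul0r R0 nmul0r.
  by rewrite nmulDr !RD nmulDr h h'.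
by rewrite insert14M /R !act23_insert insert14M /= mulRM.
Qed.

Fact leg23RL x y : R x ** y = x ** L y.
Proof.
elim/tensor4_ind: x => [|x x' h h'|c b z]; first by rewrite R0 !nmul0l.
  by rewrite RD !nmulDl h h'.
elim/tensor4_ind: y => [|y y' h h'|c' b' z']; first by rewrite L0 !nmul0r.
  by rewrite LD !nmulDr h h'.
by rewrite /R /L !act23_insert !insert14M /= mulRL.
Qed.

Definition leg23 : multiplier (A ⊗ A) :=
  Multiplier leg23L_linear leg23R_linear leg23LM leg23RM leg23RL.

End Def.
End Leg23.

Section Slices.
Variables (K : fieldType) (B C : lmodType K).

Definition tfun (f : {scalar B}) (g : {scalar C}) : B ⊗ C -> K :=
  tlift (fun b c => f b * g c : K^o).
Definition sliceL (f : {scalar B}) : B ⊗ C -> C := tlift (fun b c => f b *: c).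
Definition sliceR (g : {scalar C}) : B ⊗ C -> B := tlift (fun b c => g c *: b).

Let tfun_bil (f : {scalar B}) (g : {scalar C}) :
  bilinear_map (fun b c => f b * g c : K^o).
Proof.
split=> [c k x y|b k x y] /=; rewrite linearP.
  by rewrite mulrDl -mulrA.
by rewrite mulrDr mulrCA.
Qed.

Let sliceL_bil (f : {scalar B}) : bilinear_map (fun b (c : C) => f b *: c).
Proof.
split=> [c k x y|b k x y] /=; first by rewrite linearP scalerDl scalerA.
by rewrite scalerDr !scalerA mulrC.
Qed.

Let sliceR_bil (g : {scalar C}) : bilinear_map (fun (b : B) c => g c *: b).
Proof.
split=> [c k x y|b k x y] /=; last by rewrite linearP scalerDl scalerA.
by rewrite scalerDr !scalerA mulrC.
Qed.

Lemma tfun_tens f g b c : tfun f g (b ⊗ c) = f b * g c.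
Proof. by rewrite /tfun tlift_tens. Qed.
Lemma sliceL_tens f b c : sliceL f (b ⊗ c) = f b *: c.
Proof. by rewrite /sliceL tlift_tens. Qed.
Lemma sliceR_tens g b c : sliceR g (b ⊗ c) = g c *: b.
Proof. by rewrite /sliceR tlift_tens. Qed.

Lemma tfun_scalar f g : scalar (tfun f g).
Proof. exact: (tlift_linear (tfun_bil f g)). Qed.
HB.instance Definition _ f g :=
  GRing.isLinear.Build K (tensor B C) K *%R (tfun f g) (tfun_scalar f g).

Lemma sliceL_linear f : linear (sliceL f).
Proof. exact: tlift_linear. Qed.
Lemma sliceR_linear g : linear (sliceR g).
Proof. exact: tlift_linear. Qed.
HB.instance Definition _ f :=
  GRing.isLinear.Build K (tensor B C) C _ (sliceL f) (sliceL_linear f).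
HB.instance Definition _ g :=
  GRing.isLinear.Build K (tensor B C) B _ (sliceR g) (sliceR_linear g).

(* x lies in the image of V ⊗ W in B ⊗ C. *)
Definition in_subtensor (V : {pred B}) (W : {pred C}) (x : B ⊗ C) :=
  exists2 s : seq (B * C), all (fun p => (p.1 \in V) && (p.2 \in W)) s &
    x = \sum_(p <- s) p.1 ⊗ p.2.

End Slices.

Section Integrals.
Variables (K : fieldType) (A : nuAlgType K).

(* (ι ⊗ w)D = m in M(A): the elements (a ⊗ 1)D and D(a ⊗ 1) lie in A ⊗ A, and *)
(* a m and m a are obtained from them by applying ι ⊗ w.                      *)
Definition is_sliceR (w : {scalar A}) (D : multiplier (A ⊗ A)) (m : multiplier A) :=
  forall a : A,
    (exists2 x : A ⊗ A, mtens (emb a) 1 * D = emb x & mulR m a = sliceR w x) /\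
    (exists2 x : A ⊗ A, D * mtens (emb a) 1 = emb x & mulL m a = sliceR w x).

Definition is_sliceL (w : {scalar A}) (D : multiplier (A ⊗ A)) (m : multiplier A) :=
  forall a : A,
    (exists2 x : A ⊗ A, mtens 1 (emb a) * D = emb x & mulR m a = sliceL w x) /\
    (exists2 x : A ⊗ A, D * mtens 1 (emb a) = emb x & mulL m a = sliceL w x).

Definition left_integral (Delta : A -> multiplier (A ⊗ A))
    (At : multiplier A -> Prop) (w : {scalar A}) :=
  nonzero w /\ forall a, exists2 m, At m & is_sliceR w (Delta a) m.

Definition right_integral (Delta : A -> multiplier (A ⊗ A))
    (As : multiplier A -> Prop) (w : {scalar A}) :=
  nonzero w /\ forall a, exists2 m, As m & is_sliceL w (Delta a) m.

End Integrals.

Section SeparabilityIdempotent.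
Variables (K : fieldType) (B C : nuAlgType K).

Definition anti_isomorphism (X Y : nuAlgType K) (S : {linear X -> Y}) :=
  bijective S /\ forall x y, S (x ** y) = S y ** S x.

Variable E : multiplier (B ⊗ C).

Record regular_separability_idempotent : Prop := {
  rsi_idem : E * E = E;
  rsi_regL : forall c : C, exists x, E * mtens 1 (emb c) = emb x;
  rsi_regR : forall b : B, exists x, mtens (emb b) 1 * E = emb x;
  rsi_fullL : forall V : {pred B}, submod_closed V ->
    (forall c : C, exists2 x, in_subtensor V predT x & E * mtens 1 (emb c) = emb x) ->
    forall b, b \in V;
  rsi_fullR : forall W : {pred C}, submod_closed W ->
    (forall b : B, exists2 x, in_subtensor predT W x & mtens (emb b) 1 * E = emb x) ->
    forall c, c \in W;
  rsi_SB : exists2 SB : {linear B -> C}, anti_isomorphism SB &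
    forall b, E * mtens (emb b) 1 = E * mtens 1 (emb (SB b));
  rsi_SC : exists2 SC : {linear C -> B}, anti_isomorphism SC &
    forall c, mtens 1 (emb c) * E = mtens (emb (SC c)) 1 * E
}.

(* (phiB ⊗ ι)E = 1 *)
Definition distinguishedB (phiB : {scalar B}) :=
  forall c : C, exists2 x, E * mtens 1 (emb c) = emb x & sliceL phiB x = c.

(* (ι ⊗ phiC)E = 1 *)
Definition distinguishedC (phiC : {scalar C}) :=
  forall b : B, exists2 x, mtens (emb b) 1 * E = emb x & sliceR phiC x = b.

Local Notation A := (C ⊗ B)%type.

(* The linear map with Delta (c ⊗ b) = (c ⊗ 1) E (1 ⊗ b), where c and b stand *)
(* for c ⊗ 1 and 1 ⊗ b in M(A), and E for 1 ⊗ E ⊗ 1.                          *)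
Definition Delta_sep : A -> multiplier (A ⊗ A) :=
  tlift (fun c b =>
    mtens (mtens (emb c) 1) 1 * leg23 E * mtens 1 (mtens 1 (emb b))).

Let Delta_bil : bilinear_map (fun (c : C) (b : B) =>
    mtens (mtens (emb c) 1) 1 * leg23 E * mtens 1 (mtens 1 (emb b))
    : multiplier (A ⊗ A)).
Proof.
have b1 (X Y : nuAlgType K) k (m m' : multiplier X) (n : multiplier Y) :
    mtens (k *: m + m') n = k *: mtens m n + mtens m' n.
  by have [h _] := mtens_bilinear X Y; exact: (h n k m m').
have b2 (X Y : nuAlgType K) k (m : multiplier X) (n n' : multiplier Y) :
    mtens m (k *: n + n') = k *: mtens m n + mtens m n'.
  by have [_ h] := mtens_bilinear X Y; exact: (h m k n n').
split=> [b k c c'|c k b b'] /=.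
  by rewrite linearP !b1 !mulrDl !mulr_scalel.
by rewrite linearP !b2 mulrDr mulr_scaler.
Qed.

Lemma Delta_sep_tens c b : Delta_sep (c ⊗ b) =
  mtens (mtens (emb c) 1) 1 * leg23 E * mtens 1 (mtens 1 (emb b)).
Proof. by rewrite /Delta_sep tlift_tens. Qed.

Lemma Delta_sep_linear : linear Delta_sep.
Proof. exact: tlift_linear. Qed.
HB.instance Definition _ := GRing.isLinear.Build K _ _ _ Delta_sep Delta_sep_linear.

(* A_t = M(C) and A_s = M(B), seen inside M(A). *)
Definition At_sep (m : multiplier A) := exists n : multiplier C, m = mtens n 1.
Definition As_sep (m : multiplier A) := exists n : multiplier B, m = mtens 1 n.

End SeparabilityIdempotent.

Arguments At_sep {K} B C.
Arguments As_sep {K} B C.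

(* Main.v *)
(* Applying ι ⊗ φ_C ⊗ g to Delta(c ⊗ b) = c ⊗ E ⊗ b gives g(b) c, because     *)
(* (ι ⊗ φ_C)E = 1; hence φ_C ⊗ g is a left integral. Conversely, if φ is a    *)
(* left integral then (ι ⊗ φ(. ⊗ b))((b' ⊗ 1)E) is a multiple of b' that      *)
(* depends only on b, and since E is full this forces φ(. ⊗ b) to be that     *)
(* multiple of φ_C. Right integrals are treated in the same way. The          *)
(* anti-isomorphisms S_B and S_C let E absorb an element of B or of C, which  *)
(* makes φ_B and φ_C faithful. Elements of tensor products are compared       *)
(* through their embedding in the multiplier algebra, which is injective      *)
(* because a tensor product of nondegenerate algebras is nondegenerate: over  *)
(* a field linear functionals separate points, so slices separate tensors.    *)

(* The multiplier [Delta_sep E (c ⊗ b)] leaves [c] and [b] in the two outer legs and puts [E] in the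
   two middle ones. So (c'b' ⊗ 1)Δ(cb) is c'c ⊗ (b' ⊗ 1)E ⊗ b, and slicing the second copy of A by a
   functional w amounts to slicing (b' ⊗ 1)E by w(· ⊗ b) ([sliceR_insert14]). Integrals on A thus
   become a question about slices of E.

   If w = φ_C ⊗ g, the slice is g(b) c'c ⊗ b', which is c'b' times the element g(b)c of C
   ([left_integral_tfun]). If w is any left integral, the slice has to be c'n ⊗ b' with n in M(C),
   so w(· ⊗ b) slices (b' ⊗ 1)E to k b' with k independent of b'. Then d = w(· ⊗ b) - kφ_C slices
   every (b' ⊗ 1)E to 0, hence (b' ⊗ 1)E lies in B ⊗ ker d, and fullness gives ker d = C
   ([distinguishedC_unique], [left_integral_tfun_inv]). Right integrals are the mirror image, with
   E(1 ⊗ c) in place of (b ⊗ 1)E.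

   Faithfulness of φ_C ⊗ φ_B follows from that of its factors ([tfun_faithful]), and theirs from the
   exchange rules for S_B and S_C ([distinguishedC_faithful], [distinguishedB_faithful]). *)
Require Import Defs.
From mathcomp Require Import all_boot all_order all_algebra.
From mathcomp Require Import boolp reals complex.
From HB Require Import structures.
From mathcomp Require classical_sets.

Set Implicit Arguments.
Unset Strict Implicit.
Unset Printing Implicit Defensive.

Import GRing.Theory.
Local Open Scope ring_scope.

(* The functional sends [x] to its coordinate on [v] along a subspace that is *)
(* maximal among those avoiding [v].                                          *)
Lemma exists_functional (K : fieldType) (V : lmodType K) (v : V) :
  v != 0 -> exists h : {scalar V}, h v = 1.
Proof.
move=> v0.
pose P (W : V -> Prop) :=
  (forall k x y, W x -> W y -> W (k *: x + y)) /\ ~ W v.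
have [|W [[Wlin Wv] Wmax]] := @classical_sets.Zorn_bigcup V P.
  move=> F FP Ftot; split=> [k x y [X FX Xx] [Y FY Yy]|[X FX Xv]]; last first.
    by have [_] := FP _ FX.
  have [XY|YX] := Ftot _ _ FX FY.
    by exists Y => //; apply: (proj1 (FP _ FY)) => //; exact: XY.
  by exists X => //; apply: (proj1 (FP _ FX)) => //; exact: YX.
(* Zorn's lemma also asks for the union of the empty chain, so [P] admits the empty set and 0 must
   be adjoined by hand until maximality yields [W0]. *)
have Wlin0 k x y : W x \/ x = 0 -> W y \/ y = 0 ->
    W (k *: x + y) \/ k *: x + y = 0.
  case=> [Wx|->] Wy; last by rewrite scaler0 add0r.
  left; apply: (Wlin) => //; case: Wy => // ->.
  by rewrite -(addNr x) -scaleN1r; exact: Wlin.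
(* By maximality, the span of [W] and a new vector [u] can no longer avoid [v]. *)
have ext u : ~ W u -> exists a w, (W w \/ w = 0) /\ v = a *: u + w.
  move=> Wu; pose U z := exists a w, (W w \/ w = 0) /\ z = a *: u + w.
  apply: contrapT => Uv; apply: (Wmax U).
    split=> [x Wx|UW].
      by exists 0, x; rewrite scale0r add0r; split; [left|].
    by apply/Wu/UW; exists 1, 0; rewrite scale1r addr0; split; [right|].
  split=> // k _ _ [a [w [Ww ->]]] [b [w' [Ww' ->]]].
  exists (k * a + b), (k *: w + w'); split; first exact: Wlin0.
  by rewrite scalerDr scalerA scalerDl addrACA.
have W0 : W 0.
  apply: contrapT => W0; have [a [w []]] := ext _ W0.
  by rewrite scaler0 add0r => -[Ww|->] v_eq; [rewrite v_eq in Wv|rewrite v_eq eqxx in v0].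
have coord x : exists k, W (x - k *: v).
  have [Wx|/ext[a [w [Ww v_eq]]]] := pselect (W x).
    by exists 0; rewrite scale0r subr0.
  have {Ww} Ww : W w by case: Ww => // ->.
  have a0 : a != 0.
    by apply/eqP => a0; apply: Wv; rewrite v_eq a0 scale0r add0r.
  exists a^-1; rewrite {1}v_eq scalerDr scalerA mulVf // scale1r opprD addNKr.
  by rewrite -scaleNr -[_ *: w]addr0; exact: Wlin.
have uniq x k l : W (x - k *: v) -> W (x - l *: v) -> k = l.
  move=> Wk Wl; apply/eqP; rewrite -subr_eq0; apply/negP => /negP kl; apply: Wv.
  have := Wlin (-1) _ _ Wk Wl.
  rewrite scaleN1r opprB addrA subrK -scalerBl => /(Wlin (k - l)^-1 _ _)/(_ W0).
  by rewrite scalerA mulVf // scale1r addr0.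
pose h x : K := projT1 (cid (coord x)).
have hP x : W (x - h x *: v) by exact: projT2 (cid (coord x)).
have h_lin : scalar h.
  move=> k x y; apply: (uniq _ _ _ (hP _)).
  by rewrite scalerDl -scalerA opprD addrACA -scalerBr; exact: Wlin.
pose hm := GRing.isLinear.Build K V K *%R h h_lin.
exists (HB.pack h hm : {scalar V}); apply: (uniq v _ _ (hP v)).
by rewrite scale1r subrr.
Qed.

(** * Functionals separate vectors, and slices separate tensors *)

Section TensorSeparation.
Variables (K : fieldType) (V W : lmodType K).
Implicit Types x : V ⊗ W.

Lemma functional_eq0 (v : V) : (forall h : {scalar V}, h v = 0) -> v = 0.
Proof.
move=> hv; apply: contrapT => /eqP /exists_functional[h h1].
by have := oner_neq0 K; rewrite -h1 hv eqxx.
Qed.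

(* If [f b != 0], the relation given by the slice along [f] eliminates one    *)
(* term [b ⊗ c] of the sum.                                                   *)
Lemma sliceL_eq0 x : (forall f : {scalar V}, sliceL f x = 0) -> x = 0.
Proof.
rewrite [x]tensor_sum; move: (repr x) => s {x}.
have [n] := ubnP (size s); elim: n s => // n IH [|[b c] s] /=.
  by rewrite big_nil.
rewrite ltnS => s_lt.
have [->|b0] := eqVneq b 0.
  rewrite big_cons /= -(scale0r 0) tensZl scale0r add0r; exact: IH.
have [f fb] := exists_functional b0 => slice0.
have c_eq : c = - \sum_(p <- s) f p.1 *: p.2.
  have := slice0 f; rewrite big_cons linearD /= sliceL_tens fb scale1r linear_sum /=.
  under eq_bigr do rewrite sliceL_tens.
  by move/eqP; rewrite addr_eq0 => /eqP.
have sum_eq : \sum_(p <- (b, c) :: s) p.1 ⊗ p.2 =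
    \sum_(p <- [seq (p.1 - f p.1 *: b, p.2) | p <- s]) p.1 ⊗ p.2.
  rewrite big_cons big_map /= {1}c_eq -scaleN1r tensZr scaleN1r.
  have [_ _ Dr _ Zr] := bil_facts (@tens_bilinear K V W).
  have -> : b ⊗ (\sum_(p <- s) f p.1 *: p.2) = \sum_(p <- s) f p.1 *: (b ⊗ p.2).
    elim: s {IH s_lt slice0 c_eq} => [|p s IH].
      by rewrite !big_nil -(scale0r 0) Zr scale0r.
    by rewrite !big_cons Dr Zr IH.
  rewrite addrC -sumrB; apply: eq_bigr => p _.
  by rewrite -scaleN1r tensDl !tensZl scaleN1r.
rewrite sum_eq; apply: IH => [|h]; first by rewrite size_map.
by rewrite -sum_eq.
Qed.

End TensorSeparation.

Section TensFactors.
Variables (K : fieldType) (V W : lmodType K).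

Definition tensl (v : V) (w : W) : tensor V W := v ⊗ w.
Definition tensr (w : W) (v : V) : tensor V W := v ⊗ w.

Lemma tensl_linear v : linear (tensl v).
Proof. by move=> k w w'; rewrite /tensl tensDr tensZr. Qed.
Lemma tensr_linear w : linear (tensr w).
Proof. by move=> k v v'; rewrite /tensr tensDl tensZl. Qed.
HB.instance Definition _ v :=
  GRing.isLinear.Build K W (tensor V W) _ (tensl v) (tensl_linear v).
HB.instance Definition _ w :=
  GRing.isLinear.Build K V (tensor V W) _ (tensr w) (tensr_linear w).

End TensFactors.

(** * Calculus of slices and of product functionals *)

Section SliceTheory.
Variables (K : fieldType) (V W : lmodType K).
Implicit Types x : V ⊗ W.

Lemma slice_exchange (f : {scalar V}) (g : {scalar W}) x :
  f (sliceR g x) = g (sliceL f x).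
Proof.
elim/tensor_ind: x => [|x y hx hy|v w]; first by rewrite !linear0.
  by rewrite !linearD /= hx hy.
by rewrite sliceR_tens sliceL_tens !linearZ /= mulrC.
Qed.

Lemma sliceR_eq0 x : (forall g : {scalar W}, sliceR g x = 0) -> x = 0.
Proof.
move=> gx; apply: sliceL_eq0 => f; apply: functional_eq0 => g.
by rewrite -slice_exchange gx linear0.
Qed.

Lemma sliceL_scale k (f f' : {scalar V}) x :
  (forall v, f' v = k * f v) -> sliceL f' x = k *: sliceL f x.
Proof.
move=> ff'; elim/tensor_ind: x => [|x y hx hy|v w].
- by rewrite !linear0.
- by rewrite !linearD /= hx hy.
by rewrite !sliceL_tens ff' scalerA.
Qed.

Lemma sliceR_scale k (g g' : {scalar W}) x :
  (forall w, g' w = k * g w) -> sliceR g' x = k *: sliceR g x.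
Proof.
move=> gg'; elim/tensor_ind: x => [|x y hx hy|v w].
- by rewrite !linear0.
- by rewrite !linearD /= hx hy.
by rewrite !sliceR_tens gg' scalerA.
Qed.

Lemma sliceL_ext (f f' : {scalar V}) x : f =1 f' -> sliceL f x = sliceL f' x.
Proof.
by move=> ff'; rewrite -[RHS]scale1r; apply: sliceL_scale => v; rewrite mul1r.
Qed.

Lemma sliceR_ext (g g' : {scalar W}) x : g =1 g' -> sliceR g x = sliceR g' x.
Proof.
by move=> gg'; rewrite -[RHS]scale1r; apply: sliceR_scale => w; rewrite mul1r.
Qed.

Lemma sliceL0 (f : {scalar V}) x : (forall v, f v = 0) -> sliceL f x = 0.
Proof.
move=> f0; rewrite -(scale0r (sliceL f x)); apply: sliceL_scale => v.
by rewrite f0 mul0r.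
Qed.

Lemma sliceR0 (g : {scalar W}) x : (forall w, g w = 0) -> sliceR g x = 0.
Proof.
move=> g0; rewrite -(scale0r (sliceR g x)); apply: sliceR_scale => w.
by rewrite g0 mul0r.
Qed.

Lemma nonzero_tens (w : {scalar tensor V W}) :
  nonzero w -> exists v u, w (v ⊗ u) != 0.
Proof.
move=> [x wx]; apply: contrapT => w0; case/eqP: wx.
elim/tensor_ind: x => [|x y hx hy|v u]; first by rewrite linear0.
  by rewrite linearD /= hx hy addr0.
by apply: contrapT => /eqP wvu; apply: w0; exists v, u.
Qed.

Lemma tfun_ext (w : {scalar tensor V W}) (f : {scalar V}) (g : {scalar W}) :
  (forall v u, w (v ⊗ u) = f v * g u) -> w =1 tfun f g.
Proof.
move=> wfg; elim/tensor_ind => [|x y hx hy|v u]; first by rewrite !linear0.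
  by rewrite !linearD /= hx hy.
by rewrite wfg tfun_tens.
Qed.

Lemma tfun_nonzero (f : {scalar V}) (g : {scalar W}) :
  nonzero f -> nonzero g -> nonzero (tfun f g).
Proof.
by move=> [v fv] [w gw]; exists (v ⊗ w); rewrite /= tfun_tens mulf_neq0.
Qed.

(** Replacing each second leg w by w - g(w)w0 puts it in ker g, and the corrections add up to
    [sliceR g x] ⊗ w0 = 0. This turns a vanishing slice into the membership that fullness of E
    speaks about. *)
Lemma sliceR_ker (g : {scalar W}) w0 x : g w0 = 1 -> sliceR g x = 0 ->
  in_subtensor predT (fun w => g w == 0) x.
Proof.
move=> gw0 gx; exists [seq (p.1, p.2 - g p.2 *: w0) | p <- repr x].
  apply/allP => _ /mapP[p _ ->] /=.
  by rewrite unfold_in linearB linearZ /= gw0 mulr1 subrr.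
rewrite big_map /= [LHS]tensor_sum; apply/eqP; rewrite -subr_eq0 -sumrB; apply/eqP.
transitivity (tensr w0 (sliceR g (\sum_(p <- repr x) p.1 ⊗ p.2))); last first.
  by rewrite -tensor_sum gx linear0.
rewrite (linear_sum (sliceR g)) linear_sum /=.
apply: eq_bigr => p _; rewrite sliceR_tens /tensr tensDr opprD addrA subrr add0r.
by rewrite -scaleNr tensZr tensZl scaleNr opprK.
Qed.

Lemma sliceL_ker (f : {scalar V}) v0 x : f v0 = 1 -> sliceL f x = 0 ->
  in_subtensor (fun v => f v == 0) predT x.
Proof.
move=> fv0 fx; exists [seq (p.1 - f p.1 *: v0, p.2) | p <- repr x].
  apply/allP => _ /mapP[p _ ->] /=.
  by rewrite andbT unfold_in linearB linearZ /= fv0 mulr1 subrr.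
rewrite big_map /= [LHS]tensor_sum; apply/eqP; rewrite -subr_eq0 -sumrB; apply/eqP.
transitivity (tensl v0 (sliceL f (\sum_(p <- repr x) p.1 ⊗ p.2))); last first.
  by rewrite -tensor_sum fx linear0.
rewrite (linear_sum (sliceL f)) linear_sum /=.
apply: eq_bigr => p _; rewrite sliceL_tens /tensl tensDl opprD addrA subrr add0r.
by rewrite -scaleNr tensZr tensZl scaleNr opprK.
Qed.

End SliceTheory.

Section Multipliers.
Variables (K : fieldType) (A : nuAlgType K).
Implicit Types (a b : A) (m n : multiplier A).

Lemma mul_emb m a : m * emb a = emb (mulL m a).
Proof. by apply: multP => b /=; rewrite ?mulLM ?mulRL. Qed.

Lemma emb_mul a m : emb a * m = emb (mulR m a).
Proof. by apply: multP => b /=; rewrite ?mulRM ?mulRL. Qed.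

Lemma emb_inj : nondegenerate_alg A -> injective (@emb K A).
Proof.
move=> [nd _] a b eq_ab; apply/eqP; rewrite -subr_eq0; apply/eqP/nd => c.
rewrite nmulDl -scaleN1r nmulZl scaleN1r; apply/eqP; rewrite subr_eq0.
by rewrite -[a ** c]/(mulL (emb a) c) eq_ab.
Qed.

End Multipliers.

(** * Multipliers of a tensor product, their slices, and nondegeneracy *)

Section TensorMultipliers.
Variables (K : fieldType) (B C : nuAlgType K).

Lemma mtens1 : mtens (1 : multiplier B) (1 : multiplier C) = 1.
Proof.
apply: multP; apply: tlift_ext => [||b c]; try exact: mulL_linear;
  try exact: mulR_linear; by rewrite !(mulL_mtens, mulR_mtens).
Qed.

Lemma mtensM (m m' : multiplier B) (n n' : multiplier C) :
  mtens m n * mtens m' n' = mtens (m * m') (n * n').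
Proof.
apply: multP; apply: tlift_ext => [||b c]; try exact: mulL_linear;
  try exact: mulR_linear; by rewrite ?mulLmul ?mulRmul !(mulL_mtens, mulR_mtens).
Qed.

Lemma emb_tens (b : B) (c : C) : emb (b ⊗ c) = mtens (emb b) (emb c).
Proof.
apply: multP; apply: tlift_ext => [||b' c']; try exact: mulL_linear;
  try exact: mulR_linear; by rewrite ?mulL_mtens ?mulR_mtens /= nmul_tens.
Qed.

Lemma sliceL_mulL m n (f : {scalar B}) (x : B ⊗ C) :
  sliceL f (mulL (mtens m n) x) = mulL n (sliceL (f \o mulL m) x).
Proof.
elim/tensor_ind: x => [|x y hx hy|b c]; first by rewrite !linear0.
  by rewrite !linearD /= hx hy.
by rewrite mulL_mtens !sliceL_tens linearZ.
Qed.

Lemma sliceL_mulR m n (f : {scalar B}) (x : B ⊗ C) :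
  sliceL f (mulR (mtens m n) x) = mulR n (sliceL (f \o mulR m) x).
Proof.
elim/tensor_ind: x => [|x y hx hy|b c]; first by rewrite !linear0.
  by rewrite !linearD /= hx hy.
by rewrite mulR_mtens !sliceL_tens linearZ.
Qed.

Lemma sliceR_mulL m n (g : {scalar C}) (x : B ⊗ C) :
  sliceR g (mulL (mtens m n) x) = mulL m (sliceR (g \o mulL n) x).
Proof.
elim/tensor_ind: x => [|x y hx hy|b c]; first by rewrite !linear0.
  by rewrite !linearD /= hx hy.
by rewrite mulL_mtens !sliceR_tens linearZ.
Qed.

Lemma sliceR_mulR m n (g : {scalar C}) (x : B ⊗ C) :
  sliceR g (mulR (mtens m n) x) = mulR m (sliceR (g \o mulR n) x).
Proof.
elim/tensor_ind: x => [|x y hx hy|b c]; first by rewrite !linear0.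
  by rewrite !linearD /= hx hy.
by rewrite mulR_mtens !sliceR_tens linearZ.
Qed.

(** If x(b ⊗ c) = 0 for all b and c, the slice of x by f(· b) is annihilated by every c, hence is 0.
    Exchanging slices, f vanishes on (ι ⊗ g)(x)b for all f, so all slices (ι ⊗ g)(x) are 0. The
    other side is symmetric. *)
Lemma tensor_nondegenerate :
  nondegenerate_alg B -> nondegenerate_alg C -> nondegenerate_alg (tensor B C).
Proof.
move=> [ndBr ndBl] [ndCr ndCl]; split=> x x0.
  have slice0 (f : {scalar B}) b : sliceL (f \o mulR (emb b)) x = 0.
    apply: ndCr => c; rewrite -[LHS]/(mulR (emb c) _) -sliceL_mulR -emb_tens.
    by rewrite [mulR _ _]x0 linear0.
  apply: sliceR_eq0 => g; apply: ndBr => b; apply: functional_eq0 => f.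
  by rewrite -[LHS]/((f \o mulR (emb b)) _) slice_exchange slice0 linear0.
have slice0 (f : {scalar B}) b : sliceL (f \o mulL (emb b)) x = 0.
  apply: ndCl => c; rewrite -[LHS]/(mulL (emb c) _) -sliceL_mulL -emb_tens.
  by rewrite [mulL _ _]x0 linear0.
apply: sliceR_eq0 => g; apply: ndBl => b; apply: functional_eq0 => f.
by rewrite -[LHS]/((f \o mulL (emb b)) _) slice_exchange slice0 linear0.
Qed.

End TensorMultipliers.

(** * Multipliers of A ⊗ A acting on the outer and the middle legs *)

Section MiddleLegs.
Variables (K : fieldType) (B C : nuAlgType K).
Local Notation A := (tensor C B).

Lemma mulL_leg23 (N : multiplier (B ⊗ C)) c b z :
  mulL (leg23 N) (insert14 c b z) = insert14 c b (mulL N z).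
Proof. exact: act23_insert. Qed.

Lemma mulR_leg23 (N : multiplier (B ⊗ C)) c b z :
  mulR (leg23 N) (insert14 c b z) = insert14 c b (mulR N z).
Proof. exact: act23_insert. Qed.

Lemma mulL_mtens4 (p s : multiplier C) (q r : multiplier B) c b z :
  mulL (mtens (mtens p q) (mtens s r)) (insert14 c b z) =
  insert14 (mulL p c) (mulL r b) (mulL (mtens q s) z).
Proof.
elim/tensor_ind: z => [|x y hx hy|b' c']; first by rewrite !linear0.
  by rewrite !linearD; congr (_ + _).
by rewrite !(insert14_tens, mulL_mtens).
Qed.

Lemma mulR_mtens4 (p s : multiplier C) (q r : multiplier B) c b z :
  mulR (mtens (mtens p q) (mtens s r)) (insert14 c b z) =
  insert14 (mulR p c) (mulR r b) (mulR (mtens q s) z).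
Proof.
elim/tensor_ind: z => [|x y hx hy|b' c']; first by rewrite !linear0.
  by rewrite !linearD; congr (_ + _).
by rewrite !(insert14_tens, mulR_mtens).
Qed.

Lemma mult4_ext (m n : multiplier (A ⊗ A)) :
  (forall c b z, mulL m (insert14 c b z) = mulL n (insert14 c b z)) ->
  (forall c b z, mulR m (insert14 c b z) = mulR n (insert14 c b z)) -> m = n.
Proof.
move=> hL hR; apply: multP; elim/tensor4_ind => [|x y hx hy|//];
  by rewrite ?linear0 // !linearD /= hx hy.
Qed.

(** The shape m ⊗ N ⊗ n of the coproduct, with arbitrary multipliers in each place. The family
    contains every Δ(cb) and is stable under products with elementary multipliers, so these products
    can be computed leg by leg. *)
Definition sandwich (m : multiplier C) (N : multiplier (B ⊗ C)) (n : multiplier B)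
    : multiplier (A ⊗ A) :=
  mtens (mtens m 1) 1 * leg23 N * mtens 1 (mtens 1 n).

Lemma mulL_sandwich m N n c b z :
  mulL (sandwich m N n) (insert14 c b z) =
  insert14 (mulL m c) (mulL n b) (mulL N z).
Proof.
rewrite /sandwich -!mtens1 !mulLmul mulL_mtens4 mulL_leg23 mulL_mtens4.
by rewrite !mtens1 !mulL1.
Qed.

Lemma mulR_sandwich m N n c b z :
  mulR (sandwich m N n) (insert14 c b z) =
  insert14 (mulR m c) (mulR n b) (mulR N z).
Proof.
rewrite /sandwich -!mtens1 !mulRmul mulR_mtens4 mulR_leg23 mulR_mtens4.
by rewrite !mtens1 !mulR1.
Qed.

Lemma sandwich_emb c x b : sandwich (emb c) (emb x) (emb b) = emb (insert14 c b x).
Proof.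
apply: mult4_ext => c' b' z.
  by rewrite mulL_sandwich /= insert14M.
by rewrite mulR_sandwich /= insert14M.
Qed.

Lemma mtens4_sandwich (p s m : multiplier C) (q r n : multiplier B) N :
  mtens (mtens p q) (mtens s r) * sandwich m N n =
  sandwich (p * m) (mtens q s * N) (r * n).
Proof.
apply: mult4_ext => c b z.
  by rewrite mulLmul !(mulL_sandwich, mulL_mtens4).
by rewrite mulRmul !(mulR_sandwich, mulR_mtens4).
Qed.

Lemma sandwich_mtens4 (p s m : multiplier C) (q r n : multiplier B) N :
  sandwich m N n * mtens (mtens p q) (mtens s r) =
  sandwich (m * p) (N * mtens q s) (n * r).
Proof.
apply: mult4_ext => c b z.
  by rewrite mulLmul !(mulL_sandwich, mulL_mtens4).
by rewrite mulRmul !(mulR_sandwich, mulR_mtens4).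
Qed.

Lemma sliceR_insert14 (w : {scalar A}) c b x :
  sliceR w (insert14 c b x) = c ⊗ sliceR (w \o tensr b) x.
Proof.
elim/tensor_ind: x => [|x y hx hy|b' c'].
- by rewrite !linear0 -[c ⊗ 0]/(tensl c 0) linear0.
- by rewrite !linearD /= hx hy tensDr.
by rewrite insert14_tens !sliceR_tens tensZr.
Qed.

Lemma sliceL_insert14 (w : {scalar A}) c b x :
  sliceL w (insert14 c b x) = sliceL (w \o tensl c) x ⊗ b.
Proof.
elim/tensor_ind: x => [|x y hx hy|b' c'].
- by rewrite !linear0 -[0 ⊗ b]/(tensr b 0) linear0.
- by rewrite !linearD /= hx hy tensDl.
by rewrite insert14_tens !sliceL_tens tensZl.
Qed.

(** The slice conditions in the definition of integrals ask for a witness [x]. All maps being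
    linear, witnesses add up, so elementary tensors suffice. *)
Lemma exists_emb_tens (U W : lmodType K) (T : nuAlgType K) (Y : lmodType K)
    (F : tensor U W -> multiplier T) (G : tensor U W -> Y) (H : {linear T -> Y}) :
  linear F -> linear G ->
  (forall u w, exists2 x, F (u ⊗ w) = emb x & G (u ⊗ w) = H x) ->
  forall v, exists2 x, F v = emb x & G v = H x.
Proof.
move=> linF linG FGH.
have D (Z : lmodType K) (f : tensor U W -> Z) : linear f -> {morph f : v v' / v + v'}.
  by move=> linf v v'; have := linf 1 v v'; rewrite !scale1r.
have Z0 (Z : lmodType K) (f : tensor U W -> Z) : linear f -> f 0 = 0.
  by move=> /D fD; apply: (addrI (f 0)); rewrite -fD !addr0.
elim/tensor_ind => // [|v v' [x Fv Gv] [x' Fv' Gv']].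
  by exists 0; rewrite ?Z0 // !linear0.
by exists (x + x'); rewrite ?(D _ _ linF) ?(D _ _ linG) !linearD /= ?Fv ?Fv' ?Gv ?Gv'.
Qed.

Lemma mtens_emb_l (U W : nuAlgType K) : linear (fun u : U => mtens (emb u) (1 : multiplier W)).
Proof.
move=> k u u'; rewrite linearP.
by have [h _] := mtens_bilinear U W; exact: (h 1 k (emb u) (emb u')).
Qed.

Lemma mtens_emb_r (U W : nuAlgType K) : linear (fun w : W => mtens (1 : multiplier U) (emb w)).
Proof.
move=> k w w'; rewrite linearP.
by have [_ h] := mtens_bilinear U W; exact: (h 1 k (emb w) (emb w')).
Qed.

End MiddleLegs.

(** * Separability idempotents and their distinguished functionals *)

Section Separability.
Variables (K : fieldType) (B C : nuAlgType K).
Hypotheses (ndB : nondegenerate_alg B) (ndC : nondegenerate_alg C).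
Variable E : multiplier (B ⊗ C).
Hypothesis hE : regular_separability_idempotent E.
Local Notation A := (tensor C B).

Let ndBC : nondegenerate_alg (tensor B C) := tensor_nondegenerate ndB ndC.
Let ndA : nondegenerate_alg A := tensor_nondegenerate ndC ndB.
Let ndAA : nondegenerate_alg (tensor A A) := tensor_nondegenerate ndA ndA.
Let embK (x y : tensor B C) : emb x = emb y -> x = y := @emb_inj _ _ ndBC x y.

(** Regularity concerns only E(1 ⊗ c) and (b ⊗ 1)E; the exchange rules for S_C and S_B carry it over
    to the other two products, which two-sided slices require. *)
Lemma regular_L1 c : exists x, mtens 1 (emb c) * E = emb x.
Proof.
have [SC _ SCE] := rsi_SC hE; rewrite SCE; exact: rsi_regR hE (SC c).
Qed.

Lemma regular_R1 b : exists x, E * mtens (emb b) 1 = emb x.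
Proof.
have [SB _ SBE] := rsi_SB hE; rewrite SBE; exact: rsi_regL hE (SB b).
Qed.

Lemma mtens_comm (m : multiplier B) (n : multiplier C) :
  mtens m 1 * mtens 1 n = mtens 1 n * mtens m 1.
Proof. by rewrite !mtensM !mulr1 !mul1r. Qed.

Section DistinguishedC.
Variable phiC : {scalar C}.
Hypothesis hphiC : distinguishedC E phiC.

Lemma distinguishedC_l b x : mtens (emb b) 1 * E = emb x -> sliceR phiC x = b.
Proof. by have [y -> <-] := hphiC b => /embK ->. Qed.

(** φ_C is normalised on (b' ⊗ 1)E only. Slicing (b' ⊗ 1)E(b ⊗ 1) in its two bracketings gives b'
    times the unknown slice on one side and b'b on the other; nondegeneracy cancels b'. *)
Lemma distinguishedC_r b x : E * mtens (emb b) 1 = emb x -> sliceR phiC x = b.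
Proof.
move=> Ebx; apply/eqP; rewrite -subr_eq0; apply/eqP; apply: (proj2 ndB) => b'.
have [y yE yb'] := hphiC b'.
have xy : mulL (mtens (emb b') 1) x = mulR (mtens (emb b) 1) y.
  by apply: embK; rewrite -mul_emb -emb_mul -Ebx -yE mulrA.
have bx : sliceR phiC (mulL (mtens (emb b') 1) x) = b' ** sliceR phiC x.
  by rewrite sliceR_mulL; congr (mulL (emb b') _); exact: sliceR_ext.
have by' : sliceR phiC (mulR (mtens (emb b) 1) y) = b' ** b.
  by rewrite -[in RHS]yb' sliceR_mulR; congr (mulR (emb b) _); exact: sliceR_ext.
by rewrite nmulDr -scaleN1r nmulZr scaleN1r -bx -by' xy subrr.
Qed.

(** Since (b ⊗ 1)(1 ⊗ c)E = (b S_C(c) ⊗ 1)E, its slice by φ_C is b S_C(c); it is also the slice of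
    (b ⊗ 1)E by φ_C(c ·). If the latter functional is 0, then S_C(c) = 0 and so c = 0. For φ_C(· c)
    the same is done with c = S_B(b) and E(b ⊗ 1)(b' ⊗ 1). *)
Lemma distinguishedC_faithful : faithful phiC.
Proof.
have [SB [SB_bij _] SBE] := rsi_SB hE; have [SC [SC_bij _] SCE] := rsi_SC hE.
split=> c c0.
  apply: (bij_inj SC_bij); rewrite linear0; apply: (proj2 ndB) => b.
  have [x xE _] := hphiC b.
  transitivity (sliceR phiC (mulL (mtens 1 (emb c)) x)); last first.
    by rewrite sliceR_mulL /= sliceR0.
  symmetry; apply: distinguishedC_l.
  rewrite -mul_emb -xE mulrA -mtens_comm -mulrA SCE mulrA mtensM mulr1.
  by rewrite mul_emb.
have [b bc] : exists b, SB b = c by case: SB_bij => g _ gK; exists (g c).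
rewrite -{}bc in c0 *.
suff -> : b = 0 by rewrite linear0.
apply: (proj1 ndB) => b'; have [y yE] := regular_R1 b'.
transitivity (sliceR phiC (mulR (mtens 1 (emb (SB b))) y)); last first.
  by rewrite sliceR_mulR /= sliceR0.
symmetry; apply: distinguishedC_r.
rewrite -emb_mul -yE -mulrA mtens_comm mulrA -SBE -mulrA mtensM mulr1.
by rewrite mul_emb.
Qed.

End DistinguishedC.

Section DistinguishedB.
Variable phiB : {scalar B}.
Hypothesis hphiB : distinguishedB E phiB.

Lemma distinguishedB_r c x : E * mtens 1 (emb c) = emb x -> sliceL phiB x = c.
Proof. by have [y -> <-] := hphiB c => /embK ->. Qed.

Lemma distinguishedB_l c x : mtens 1 (emb c) * E = emb x -> sliceL phiB x = c.
Proof.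
move=> Ecx; apply/eqP; rewrite -subr_eq0; apply/eqP; apply: (proj1 ndC) => c'.
have [y yE yc'] := hphiB c'.
have xy : mulR (mtens 1 (emb c')) x = mulL (mtens 1 (emb c)) y.
  by apply: embK; rewrite -mul_emb -emb_mul -Ecx -yE mulrA.
have xc : sliceL phiB (mulR (mtens 1 (emb c')) x) = sliceL phiB x ** c'.
  by rewrite sliceL_mulR; congr (mulR (emb c') _); exact: sliceL_ext.
have yc : sliceL phiB (mulL (mtens 1 (emb c)) y) = c ** c'.
  by rewrite -[in RHS]yc' sliceL_mulL; congr (mulL (emb c) _); exact: sliceL_ext.
by rewrite nmulDl -scaleN1r nmulZl scaleN1r -xc -yc xy subrr.
Qed.

(** Mirror image of the argument for φ_C: S_B(b)c is the slice of E(1 ⊗ c) by φ_B(· b), and c'c is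
    that of (1 ⊗ c')E by φ_B(S_C(c) ·). *)
Lemma distinguishedB_faithful : faithful phiB.
Proof.
have [SB [SB_bij _] SBE] := rsi_SB hE; have [SC [SC_bij _] SCE] := rsi_SC hE.
split=> b b0; last first.
  apply: (bij_inj SB_bij); rewrite linear0; apply: (proj1 ndC) => c.
  have [x xE _] := hphiB c.
  transitivity (sliceL phiB (mulR (mtens (emb b) 1) x)); last first.
    by rewrite sliceL_mulR /= sliceL0.
  symmetry; apply: distinguishedB_r.
  rewrite -emb_mul -xE -mulrA -mtens_comm mulrA SBE -mulrA mtensM mulr1.
  by rewrite mul_emb.
have [c cb] : exists c, SC c = b by case: SC_bij => g _ gK; exists (g b).
rewrite -{}cb in b0 *.
suff -> : c = 0 by rewrite linear0.
apply: (proj2 ndC) => c'; have [y yE] := regular_L1 c'.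
transitivity (sliceL phiB (mulL (mtens (emb (SC c)) 1) y)); last first.
  by rewrite sliceL_mulL /= sliceL0.
symmetry; apply: distinguishedB_l.
rewrite -mul_emb -yE mulrA mtens_comm -mulrA -SCE mulrA mtensM mulr1.
by rewrite mul_emb.
Qed.

End DistinguishedB.

Lemma Delta_sandwich c b : Delta_sep E (c ⊗ b) = sandwich (emb c) E (emb b).
Proof. exact: Delta_sep_tens. Qed.

Lemma Delta_ll c b c' b' x : mtens (emb b') 1 * E = emb x ->
  mtens (emb (c' ⊗ b')) 1 * Delta_sep E (c ⊗ b) = emb (insert14 (c' ** c) b x).
Proof.
move=> xE; rewrite Delta_sandwich emb_tens -mtens1 mtens4_sandwich xE.
by rewrite emb_mul mul1r sandwich_emb.
Qed.

Lemma Delta_lr c b c' b' x : E * mtens (emb b') 1 = emb x ->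
  Delta_sep E (c ⊗ b) * mtens (emb (c' ⊗ b')) 1 = emb (insert14 (c ** c') b x).
Proof.
move=> xE; rewrite Delta_sandwich emb_tens -mtens1 sandwich_mtens4 xE.
by rewrite mul_emb mulr1 sandwich_emb.
Qed.

Lemma Delta_rl c b c' b' x : mtens 1 (emb c') * E = emb x ->
  mtens 1 (emb (c' ⊗ b')) * Delta_sep E (c ⊗ b) = emb (insert14 c (b' ** b) x).
Proof.
move=> xE; rewrite Delta_sandwich emb_tens -mtens1 mtens4_sandwich xE.
by rewrite emb_mul mul1r sandwich_emb.
Qed.

Lemma Delta_rr c b c' b' x : E * mtens 1 (emb c') = emb x ->
  Delta_sep E (c ⊗ b) * mtens 1 (emb (c' ⊗ b')) = emb (insert14 c (b ** b') x).
Proof.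
move=> xE; rewrite Delta_sandwich emb_tens -mtens1 sandwich_mtens4 xE.
by rewrite mul_emb mulr1 sandwich_emb.
Qed.

(** * Left integrals *)

Section LeftIntegrals.
Variable phiC : {scalar C}.
Hypotheses (hphiC : distinguishedC E phiC) (phiC_neq0 : nonzero phiC).

Lemma left_integral_tfun (g : {scalar B}) : nonzero g ->
  left_integral (Delta_sep E) (At_sep B C) (tfun phiC g).
Proof.
move=> g0; split=> [|a]; first exact: tfun_nonzero.
(* For a = cb this is the element g(b)c of C. *)
exists (mtens (emb (sliceR g a)) 1); first by exists (emb (sliceR g a)).
have val c b u x b' : sliceR phiC x = b' ->
    sliceR (tfun phiC g) (insert14 (u ** c) b x) = g b *: ((u ** c) ⊗ b').
  move=> <-; rewrite sliceR_insert14 -tensZr; congr (_ ⊗ _).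
  by apply: sliceR_scale => c1 /=; rewrite /tensr tfun_tens mulrC.
move=> a'; split.
  move: a'; apply: exists_emb_tens => [k x y|k x y|c' b'].
  - by rewrite mtens_emb_l mulrDl mulr_scalel.
  - exact: mulR_linear.
  move: a; apply: exists_emb_tens => [k x y|k x y|c b].
  - by rewrite linearP mulrDr mulr_scaler.
  - by rewrite linearP mtens_emb_l mulRD mulRZ.
  have [x xE xb'] := hphiC b'; exists (insert14 (c' ** c) b x).
    exact: Delta_ll.
  rewrite [RHS](val _ _ _ _ _ xb') mulR_mtens mulR1 sliceR_tens /=.
  by rewrite nmulZr tensZl.
move: a'; apply: exists_emb_tens => [k x y|k x y|c' b'].
- by rewrite mtens_emb_l mulrDr mulr_scaler.
- exact: mulL_linear.
move: a; apply: exists_emb_tens => [k x y|k x y|c b].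
- by rewrite linearP mulrDl mulr_scalel.
- by rewrite linearP mtens_emb_l mulLD mulLZ.
have [x xE] := regular_R1 b'; exists (insert14 (c ** c') b x).
  exact: Delta_lr.
rewrite [RHS](val _ _ _ _ _ (distinguishedC_r hphiC xE)) mulL_mtens mulL1 sliceR_tens /=.
by rewrite nmulZl tensZl.
Qed.

(** The difference d = w - kφ_C slices every (b ⊗ 1)E to 0, so each of these lies in B ⊗ ker d; as E
    is full, ker d is all of C. *)
Lemma distinguishedC_unique (w : {scalar C}) k :
  (forall b x, mtens (emb b) 1 * E = emb x -> sliceR w x = k *: b) ->
  forall c, w c = k * phiC c.
Proof.
move=> wk; pose d : {scalar C} := w \- (phiC \o *:%R k).
have dE c : d c = w c - k * phiC c by rewrite /d /= linearZ.
suff d0 c : d c = 0 by move=> c; apply/eqP; rewrite -subr_eq0 -dE d0.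
apply: contrapT => /eqP dc.
have dc1 : d ((d c)^-1 *: c) = 1 by rewrite linearZ /= mulVf.
suff /eqP : d c == 0 by apply/eqP.
apply: (rsi_fullR hE (W := fun c => d c == 0)).
  split=> [|l x y]; rewrite !unfold_in; first by rewrite linear0.
  by rewrite linearP /= => /eqP-> /eqP->; rewrite mulr0 addr0.
move=> b; have [x xE xb] := hphiC b; exists x => //.
apply: (sliceR_ker dc1); have -> : sliceR d x = sliceR w x - k *: sliceR phiC x.
  elim/tensor_ind: {xE xb} x => [|x y hx hy|u v].
  - by rewrite !linear0 addr0.
  - by rewrite !linearD /= hx hy addrACA.
  by rewrite !sliceR_tens dE scalerBl scalerA.
by rewrite xb (wk b) // subrr.
Qed.

Lemma left_integral_tfun_inv (phi : {scalar A}) :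
  left_integral (Delta_sep E) (At_sep B C) phi ->
  exists2 g : {scalar B}, nonzero g & phi =1 tfun phiC g.
Proof.
move=> [phi0 slices]; have [c0 c0_neq0] := phiC_neq0.
(* A functional [h] equal to 1 on a nonzero product c'c'' will strip off the outer leg in C, leaving
   only the slice of E. *)
have [c' [c'' cc]] : exists c' c'' : C, c' ** c'' != 0.
  exists c0; apply: contrapT => h; case/eqP: c0_neq0.
  rewrite ((proj1 ndC) c0) ?linear0 // => c.
  by apply: contrapT => /eqP cc; apply: h; exists c.
have [h h1] := exists_functional cc.
(* The coefficient is h(c'n). It is the same for all b', because the multiplier n ⊗ 1 does not touch
   the leg B. *)
have coeff b : exists k, forall c, phi (c ⊗ b) = k * phiC c.
  have [_ [n ->] sl] := slices (c'' ⊗ b); exists (h (mulR n c')).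
  apply: (@distinguishedC_unique (phi \o tensr b)) => b' x xE.
  have [[y yE ysl] _] := sl (c' ⊗ b').
  have {yE} y_eq : y = insert14 (c' ** c'') b x.
    by apply: (emb_inj ndAA); rewrite -yE; exact: Delta_ll.
  move/(congr1 (sliceL h)): ysl; rewrite mulR_mtens mulR1 sliceL_tens => ->.
  by rewrite y_eq sliceR_insert14 sliceL_tens h1 scale1r.
(* Evaluating φ at a vector where φ_C is 1 recovers the coefficient as a functional linear in b. *)
have c1 : phiC ((phiC c0)^-1 *: c0) = 1 by rewrite linearZ /= mulVf.
pose g : {scalar B} := phi \o tensl ((phiC c0)^-1 *: c0).
have phiE c b : phi (c ⊗ b) = phiC c * g b.
  by have [k kE] := coeff b; rewrite /g /= /tensl !kE c1 mulr1 mulrC.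
exists g; last exact: tfun_ext.
have [c [b]] := nonzero_tens phi0; rewrite phiE mulf_eq0 negb_or => /andP[_ gb].
by exists b.
Qed.

End LeftIntegrals.

(** * Right integrals *)

Section RightIntegrals.
Variable phiB : {scalar B}.
Hypotheses (hphiB : distinguishedB E phiB) (phiB_neq0 : nonzero phiB).

Lemma right_integral_tfun (f : {scalar C}) : nonzero f ->
  right_integral (Delta_sep E) (As_sep B C) (tfun f phiB).
Proof.
move=> f0; split=> [|a]; first exact: tfun_nonzero.
exists (mtens 1 (emb (sliceL f a))); first by exists (emb (sliceL f a)).
have val c b u x c' : sliceL phiB x = c' ->
    sliceL (tfun f phiB) (insert14 c (u ** b) x) = f c *: (c' ⊗ (u ** b)).
  move=> <-; rewrite sliceL_insert14 -tensZl; congr (_ ⊗ _).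
  by apply: sliceL_scale => b1 /=; rewrite /tensl tfun_tens.
move=> a'; split.
  move: a'; apply: exists_emb_tens => [k x y|k x y|c' b'].
  - by rewrite mtens_emb_r mulrDl mulr_scalel.
  - exact: mulR_linear.
  move: a; apply: exists_emb_tens => [k x y|k x y|c b].
  - by rewrite linearP mulrDr mulr_scaler.
  - by rewrite linearP mtens_emb_r mulRD mulRZ.
  have [x xE] := regular_L1 c'; exists (insert14 c (b' ** b) x).
    exact: Delta_rl.
  rewrite [RHS](val _ _ _ _ _ (distinguishedB_l hphiB xE)) mulR_mtens mulR1 sliceL_tens /=.
  by rewrite nmulZr tensZr.
move: a'; apply: exists_emb_tens => [k x y|k x y|c' b'].
- by rewrite mtens_emb_r mulrDr mulr_scaler.
- exact: mulL_linear.
move: a; apply: exists_emb_tens => [k x y|k x y|c b].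
- by rewrite linearP mulrDl mulr_scalel.
- by rewrite linearP mtens_emb_r mulLD mulLZ.
have [x xE xc'] := hphiB c'; exists (insert14 c (b ** b') x).
  exact: Delta_rr.
rewrite [RHS](val _ _ _ _ _ xc') mulL_mtens mulL1 sliceL_tens /=.
by rewrite nmulZl tensZr.
Qed.

Lemma distinguishedB_unique (w : {scalar B}) k :
  (forall c x, E * mtens 1 (emb c) = emb x -> sliceL w x = k *: c) ->
  forall b, w b = k * phiB b.
Proof.
move=> wk; pose d : {scalar B} := w \- (phiB \o *:%R k).
have dE b : d b = w b - k * phiB b by rewrite /d /= linearZ.
suff d0 b : d b = 0 by move=> b; apply/eqP; rewrite -subr_eq0 -dE d0.
apply: contrapT => /eqP db.
have db1 : d ((d b)^-1 *: b) = 1 by rewrite linearZ /= mulVf.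
suff /eqP : d b == 0 by apply/eqP.
apply: (rsi_fullL hE (V := fun b => d b == 0)).
  split=> [|l x y]; rewrite !unfold_in; first by rewrite linear0.
  by rewrite linearP /= => /eqP-> /eqP->; rewrite mulr0 addr0.
move=> c; have [x xE xc] := hphiB c; exists x => //.
apply: (sliceL_ker db1); have -> : sliceL d x = sliceL w x - k *: sliceL phiB x.
  elim/tensor_ind: {xE xc} x => [|x y hx hy|u v].
  - by rewrite !linear0 addr0.
  - by rewrite !linearD /= hx hy addrACA.
  by rewrite !sliceL_tens dE scalerBl scalerA.
by rewrite xc (wk c) // subrr.
Qed.

Lemma right_integral_tfun_inv (psi : {scalar A}) :
  right_integral (Delta_sep E) (As_sep B C) psi ->
  exists2 f : {scalar C}, nonzero f & psi =1 tfun f phiB.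
Proof.
move=> [psi0 slices]; have [b0 b0_neq0] := phiB_neq0.
have [b'' [b' bb]] : exists b'' b' : B, b'' ** b' != 0.
  exists b0; apply: contrapT => h; case/eqP: b0_neq0.
  rewrite ((proj1 ndB) b0) ?linear0 // => b.
  by apply: contrapT => /eqP bb; apply: h; exists b.
have [h h1] := exists_functional bb.
(* Here Δ(cb'') is multiplied by 1 ⊗ c'b' from the right, since fullness in B is expressed through
   E(1 ⊗ c'); the coefficient is then h(nb'). *)
have coeff c : exists k, forall b, psi (c ⊗ b) = k * phiB b.
  have [_ [n ->] sl] := slices (c ⊗ b''); exists (h (mulL n b')).
  apply: (@distinguishedB_unique (psi \o tensl c)) => c' x xE.
  have [_ [y yE ysl]] := sl (c' ⊗ b').
  have {yE} y_eq : y = insert14 c (b'' ** b') x.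
    by apply: (emb_inj ndAA); rewrite -yE; exact: Delta_rr.
  move/(congr1 (sliceR h)): ysl; rewrite mulL_mtens mulL1 sliceR_tens => ->.
  by rewrite y_eq sliceL_insert14 sliceR_tens h1 scale1r.
have b1 : phiB ((phiB b0)^-1 *: b0) = 1 by rewrite linearZ /= mulVf.
pose f : {scalar C} := psi \o tensr ((phiB b0)^-1 *: b0).
have psiE c b : psi (c ⊗ b) = f c * phiB b.
  by have [k kE] := coeff c; rewrite /f /= /tensr !kE b1 mulr1.
exists f; last exact: tfun_ext.
have [c [b]] := nonzero_tens psi0; rewrite psiE mulf_eq0 negb_or => /andP[fc _].
by exists c.
Qed.

End RightIntegrals.
End Separability.

(** Applying f after slicing by g separates the two factors: faithfulness of f kills the slices of x
    by g(· c), then faithfulness of g kills the slices of x by any functional on B, and slices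
    separate tensors. *)
Lemma tfun_faithful (K : fieldType) (B C : nuAlgType K) (f : {scalar B}) (g : {scalar C}) :
  faithful f -> faithful g -> faithful (tfun f g).
Proof.
have tfunE (f' : {scalar B}) (g' : {scalar C}) x : tfun f' g' x = f' (sliceR g' x).
  elim/tensor_ind: x => [|x y hx hy|b c]; first by rewrite !linear0.
    by rewrite !linearD /= hx hy.
  by rewrite tfun_tens sliceR_tens linearZ /= mulrC.
move=> [fr fl] [gr gl]; split=> x x0.
  have slice0 c : sliceR (g \o mulR (emb c)) x = 0.
    apply: fr => b; rewrite -[_ ** b]/(mulR (emb b) _) -sliceR_mulR -emb_tens -tfunE.
    exact: x0.
  apply: sliceL_eq0 => h; apply: gr => c.
  by rewrite -[LHS]/((g \o mulR (emb c)) _) -slice_exchange slice0 linear0.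
have slice0 c : sliceR (g \o mulL (emb c)) x = 0.
  apply: fl => b; rewrite -[b ** _]/(mulL (emb b) _) -sliceR_mulL -emb_tens -tfunE.
  exact: x0.
apply: sliceL_eq0 => h; apply: gl => c.
by rewrite -[LHS]/((g \o mulL (emb c)) _) -slice_exchange slice0 linear0.
Qed.

Theorem proposition2p2 (R : realType) (B C : nuAlgType R[i])
    (ndB : nondegenerate_alg B) (ndC : nondegenerate_alg C)
    (idB : idempotent_alg B) (idC : idempotent_alg C)
    (neB : exists b : B, b != 0)
    (E : multiplier (B ⊗ C)) (hE : regular_separability_idempotent E)
    (phiB : {scalar B}) (phiC : {scalar C})
    (hphiB : distinguishedB E phiB) (hphiC : distinguishedC E phiC) :
  (forall g : {scalar B}, nonzero g ->
     left_integral (Delta_sep E) (At_sep B C) (tfun phiC g)) /\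
  (forall phi : {scalar (C ⊗ B)%type},
     left_integral (Delta_sep E) (At_sep B C) phi ->
     exists2 g : {scalar B}, nonzero g & phi =1 tfun phiC g) /\
  (forall f : {scalar C}, nonzero f ->
     right_integral (Delta_sep E) (As_sep B C) (tfun f phiB)) /\
  (forall psi : {scalar (C ⊗ B)%type},
     right_integral (Delta_sep E) (As_sep B C) psi ->
     exists2 f : {scalar C}, nonzero f & psi =1 tfun f phiB) /\
  faithful (tfun phiC phiB) /\
  left_integral (Delta_sep E) (At_sep B C) (tfun phiC phiB) /\
  right_integral (Delta_sep E) (As_sep B C) (tfun phiC phiB).
Proof.
have faithB := distinguishedB_faithful ndB ndC hE hphiB.
have faithC := distinguishedC_faithful ndB ndC hE hphiC.
have [b0 b0_neq0] := neB.
(* The zero functional could not return [b0] as a slice. *)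
have phiC_neq0 : nonzero phiC.
  apply: contrapT => phiC0; case/eqP: b0_neq0; have [x _ <-] := hphiC b0.
  by apply: sliceR0 => c; apply: contrapT => /eqP pc; apply: phiC0; exists c.
have phiB_neq0 : nonzero phiB.
  apply: contrapT => phiB0; case/eqP: b0_neq0; apply: (proj1 faithB) => b.
  by apply: contrapT => /eqP pb; apply: phiB0; exists (b0 ** b).
split; first by move=> g; exact: left_integral_tfun.
split; first by move=> phi; exact: left_integral_tfun_inv.
split; first by move=> f; exact: right_integral_tfun.
split; first by move=> psi; exact: right_integral_tfun_inv.
split; first exact: tfun_faithful.
by split; [exact: left_integral_tfun|exact: right_integral_tfun].
Qed.
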